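(* Let $((F,\nu,N),[\cdot,\cdot]_{F,h},(\rho,\eta))$ be a generalized Lie algebroid, $(E,\pi,M)$ a vector bundle and $(g,h)$ a locally invertible vector bundle morphism from $(E,\pi,M)$ to $(F,\nu,N)$. Let $u\in\Gamma(E,\pi,M)$. Then there exists a unique vector field $u^{c}\in\Gamma(TE,\tau_E,E)$ on $E$ (the complete $(g,h)$-lift of $u$) satisfying the following two conditions: (i) $u^{c}$ is $(h\circ\pi)$-related with the vector field $\Gamma(Th\circ\rho,h\circ\eta)(\Gamma(g,h)u)$ on $N$, i.e. $T(h\circ\pi)(u^{c}_{v_x})=\{\Gamma(Th\circ\rho,h\circ\eta)(\Gamma(g,h)u)\}(h\circ\pi(v_x))$ for all $v_x\in E$; (ii) $u^{c}(\hat\omega)=\widehat{(g,h)\mathcal L_u\omega}$ for all $\omega\in\Lambda^1(E,\pi,M)$.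
   Context: All objects are smooth; $\mathcal F(M)=C^\infty(M)$; $\Gamma(E,\pi,M)$ denotes the sections of $(E,\pi,M)$; repeated indices are summed. Generalized Lie algebroid: $M,N$ are $m$-dimensional manifolds, $h:M\to N$ and $\eta:N\to M$ are diffeomorphisms, $(F,\nu,N)$ is a vector bundle, $(\rho,\eta)$ is a vector bundle morphism from $(F,\nu,N)$ to $(TM,\tau_M,M)$ ($\rho$ covers $\eta$), and $[\cdot,\cdot]_{F,h}$ is a Lie bracket on $\Gamma(F,\nu,N)$ with $[z,f w]_{F,h}=f[z,w]_{F,h}+\big(\Gamma(Th\circ\rho,h\circ\eta)(z)f\big)w$ for $f\in\mathcal F(N)$. Here, for a local frame $(t_\alpha)$ of $F$, local coordinates $(x^i)$ on $M$, and $\rho_\alpha^i$ the local component functions of $\rho$ (functions on $N$), $\Gamma(Th\circ\rho,h\circ\eta)(z)$ is the vector field on $N$ acting on $f\in\mathcal F(N)$ by $\Gamma(Th\circ\rho,h\circ\eta)(z^\alpha t_\alpha)(f)=z^\alpha\rho^i_\alpha\,\big(\tfrac{\partial(f\circ h)}{\partial x^i}\circ h^{-1}\big)$ (understood to be globally well defined); $z\mapsto\Gamma(Th\circ\rho,h\circ\eta)(z)$ is a Lie algebra morphism to vector fields on $N$. $(E,\pi,M)$ has rank $r$, local frame $(s_a)$, fibre coordinates $y^a$. $(g,h)$ is a vector bundle morphism $E\to F$ covering $h$ with components $g_b^\alpha$ (local functions on $M$), locally invertible: on each chart there are functions $\tilde g^b_\alpha$ with $\tilde g^b_\alpha g^\alpha_a=\delta^b_a$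 and $\tilde g^a_\alpha g_a^\beta=\delta^\beta_\alpha$. $\Gamma(g,h)(u^as_a)=((g^\alpha_au^a)\circ h^{-1})t_\alpha$, with inverse $\Gamma(g^{-1},h^{-1})(z^\alpha t_\alpha)=\tilde g^b_\alpha(z^\alpha\circ h)s_b$. $\Lambda^1(E,\pi,M)$ is the module of $\mathcal F(M)$-linear maps $\Gamma(E,\pi,M)\to\mathcal F(M)$. The covariant Lie $(g,h)$-derivative of $\omega\in\Lambda^1(E,\pi,M)$ with respect to $u$ is $$((g,h)\mathcal L_u\omega)(v)=\{\Gamma(Th\circ\rho,h\circ\eta)(\Gamma(g,h)u)(\omega(v)\circ h^{-1})\}\circ h-\omega\big(\Gamma(g^{-1},h^{-1})[\Gamma(g,h)u,\Gamma(g,h)v]_{F,h}\big).$$ For $\omega=\omega_as^a$ ($s^a$ the dual frame), $\hat\omega\in\mathcal F(E)$ is the function locally given by $\hat\omega=y^a(\omega_a\circ\pi)$. *)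

(* Defs.v *)
From mathcomp Require Export all_boot all_order all_algebra.
From mathcomp Require Export all_classical all_reals all_analysis.
Set Implicit Arguments.
Unset Strict Implicit.
Unset Printing Implicit Defensive.
Export Order.TTheory GRing.Theory Num.Theory numFieldNormedType.Exports.
Local Open Scope classical_set_scope.
Local Open Scope ring_scope.

(* [U] is meant to be open in R^n: all partial derivatives of order at most
   [k] exist and are continuous at the points of [U]. *)
Fixpoint Ck (R : realType) (n k : nat) (U : set 'rV[R]_n)
    (f : 'rV[R]_n -> R) : Prop :=
  (forall x, U x -> {for x, continuous f}) /\
  if k is k'.+1 then
    forall i : 'I_n,
      (forall x, U x -> derivable f x (delta_mx 0 i)) /\
      Ck k' U (fun x => 'D_(delta_mx 0 i) f x)
  else True.

Definition Cinf (R : realType) (n : nat) (U : set 'rV[R]_n)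
    (f : 'rV[R]_n -> R) : Prop := forall k, Ck k U f.

(* [cmap] and [cinv] are total functions, relevant only on [cdom] and on
   [cmap @` cdom] respectively. *)
Record chart (R : realType) (T : topologicalType) (n : nat) := Chart {
  cdom : set T;
  cmap : T -> 'rV[R]_n;
  cinv : 'rV[R]_n -> T;
  cdom_open : open cdom;
  ccod_open : open (cmap @` cdom);
  cmapK : forall x, cdom x -> cinv (cmap x) = x;
  cmap_cont : forall x, cdom x -> {for x, continuous cmap};
  cinv_cont : forall y, (cmap @` cdom) y -> {for y, continuous cinv} }.

(* The atlas is not required to be maximal. *)
Record manifold (R : realType) (m : nat) := Manifold {
  msort :> topologicalType;
  atlas : set (chart R msort m);
  m_hausdorff : hausdorff_space msort;
  m_second_countable : @second_countable msort;
  atlas_cover : forall x : msort, exists2 phi, atlas phi & cdom phi x;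
  atlas_compat : forall phi psi, atlas phi -> atlas psi ->
    forall j, Cinf (cmap phi @` (cdom phi `&` cdom psi))
      (fun y => cmap psi (cinv phi y) 0 j) }.

Section Smoothness.
Variable R : realType.

(* Smoothness on an open set [A] of a function f : M -> R. *)
Definition smooth_fun_on m (M : manifold R m) (A : set M) (f : M -> R) : Prop :=
  forall phi, @atlas R m M phi ->
    Cinf (cmap phi @` (A `&` cdom phi)) (f \o cinv phi).

(* Membership in F(M). *)
Definition smooth_fun m (M : manifold R m) (f : M -> R) : Prop :=
  smooth_fun_on setT f.

(* Smoothness on an open set [A] of R^n of a map R^n -> M. *)
Definition smooth_from_on n m (M : manifold R m) (A : set 'rV[R]_n)
    (f : 'rV[R]_n -> M) : Prop :=
  (forall y, A y -> {for y, continuous f}) /\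
  forall psi, @atlas R m M psi ->
    forall j, Cinf (A `&` f @^-1` cdom psi) (fun y => cmap psi (f y) 0 j).

Definition smooth_map m n (M : manifold R m) (N : manifold R n)
    (f : M -> N) : Prop :=
  forall phi, @atlas R m M phi ->
    smooth_from_on (cmap phi @` cdom phi) (f \o cinv phi).

Record diffeomorphism m n (M : manifold R m) (N : manifold R n) := Diffeo {
  dfun :> M -> N;
  dinv : N -> M;
  dfunK : cancel dfun dinv;
  dinvK : cancel dinv dfun;
  dfun_smooth : smooth_map dfun;
  dinv_smooth : smooth_map dinv }.

(* The coordinate derivative (d/dx^i)|_x in the chart [phi]. *)
Definition partial m (M : manifold R m) (phi : chart R M m) (i : 'I_m)
    (x : M) (f : M -> R) : R :=
  'D_(delta_mx 0 i) (f \o cinv phi) (cmap phi x).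

(* T_xM is the space of the functionals sum_i c_i (d/dx^i)|_x on F(M); by the
   chain rule it does not depend on the chart.  So that equality of functionals
   on M -> R is equality of functionals on F(M), they are extended by 0 to the
   functions that are not smooth. *)
Definition tangent m (M : manifold R m) (x : M) (D : (M -> R) -> R) : Prop :=
  (exists phi, [/\ @atlas R m M phi, cdom phi x &
     exists c : 'I_m -> R, forall f, smooth_fun f ->
       D f = \sum_i c i * partial phi i x f]) /\
  (forall f, ~ smooth_fun f -> D f = 0).

(* T f : T_xM -> T_(f x)N *)
Definition tangent_map m n (M : manifold R m) (N : manifold R n) (f : M -> N)
    (D : (M -> R) -> R) : (N -> R) -> R :=
  fun k => if `[< smooth_fun k >] then D (k \o f) else 0.

(* Smooth sections of the tangent bundle. *)
Definition vector_field m (M : manifold R m) (X : M -> (M -> R) -> R) : Prop :=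
  (forall x, tangent x (X x)) /\
  (forall f, smooth_fun f -> smooth_fun (fun x => X x f)).

Definition vf_bracket m (M : manifold R m) (X Y : M -> (M -> R) -> R) :
    M -> (M -> R) -> R :=
  fun x f => X x (fun y => Y y f) - Y x (fun y => X y f).

(* [vadd] is relevant only for two vectors of the same fibre. *)
Record bundleData m (M : manifold R m) (r : nat) := BundleData {
  vtot :> manifold R (m + r);
  vproj : vtot -> M;
  vadd : vtot -> vtot -> vtot;
  vscale : R -> vtot -> vtot }.

(* [(vproj, tcoord)] is a diffeomorphism from the part of the bundle above
   [tdom] onto [tdom * R^r], linear on the fibres, with inverse [tpoint].
   Equivalently: a local frame s_a(x) = tpoint x e_a over [tdom], with fibre
   coordinates y^a(w) = tcoord w 0 a and tpoint x c = sum_a c_a s_a(x). *)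
Record trivialization m (M : manifold R m) r (B : bundleData M r) := Triv {
  tdom : set M;
  tcoord : B -> 'rV[R]_r;
  tpoint : M -> 'rV[R]_r -> B;
  tdom_open : open tdom;
  tpoint_proj : forall x c, tdom x -> vproj (tpoint x c) = x;
  tpointK : forall x c, tdom x -> tcoord (tpoint x c) = c;
  tcoordK : forall w, tdom (vproj w) -> tpoint (vproj w) (tcoord w) = w;
  tcoordD : forall v w, tdom (vproj v) -> vproj v = vproj w ->
    tcoord (vadd v w) = tcoord v + tcoord w;
  tcoordZ : forall a w, tdom (vproj w) ->
    tcoord (vscale a w) = a *: tcoord w;
  tcoord_smooth : forall a : 'I_r,
    smooth_fun_on (vproj (b := B) @^-1` tdom) (fun w => tcoord w 0 a);
  tpoint_smooth : forall phi, @atlas R m M phi ->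
    smooth_from_on
      [set y : 'rV[R]_(m + r) | (cmap phi @` (tdom `&` cdom phi)) (lsubmx y)]
      (fun y => tpoint (cinv phi (lsubmx y)) (rsubmx y)) }.

Definition tframe m (M : manifold R m) r (B : bundleData M r)
    (t : trivialization B) (a : 'I_r) (x : M) : B := tpoint t x (delta_mx 0 a).

(* The vector space axioms of the fibres hold because a local trivialization
   carries [vadd] and [vscale] to the operations of R^r. *)
Record vectorBundle m (M : manifold R m) (r : nat) := VectorBundle {
  vdata :> bundleData M r;
  vproj_smooth : smooth_map (vproj (b := vdata));
  vproj_add : forall v w : vdata, vproj v = vproj w ->
    vproj (vadd v w) = vproj v;
  vproj_scale : forall a (w : vdata), vproj (vscale a w) = vproj w;
  vtriv : forall x, exists t : trivialization vdata, tdom t x }.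

(* Gamma(E, pi, M) *)
Definition smooth_section m (M : manifold R m) r (E : vectorBundle M r)
    (u : M -> E) : Prop :=
  smooth_map u /\ forall x, vproj (u x) = x.

Definition sadd m (M : manifold R m) r (E : vectorBundle M r) (u v : M -> E) :
  M -> E := fun x => vadd (u x) (v x).

Definition sscale m (M : manifold R m) r (E : vectorBundle M r) (f : M -> R)
  (u : M -> E) : M -> E := fun x => vscale (f x) (u x).

Definition bundle_morphism m n (M : manifold R m) (N : manifold R n) r p
    (E : vectorBundle M r) (F : vectorBundle N p) (h : M -> N)
    (g : E -> F) : Prop :=
  [/\ smooth_map g,
      forall w, vproj (g w) = h (vproj w),
      forall v w, vproj v = vproj w -> g (vadd v w) = vadd (g v) (g w) &
      forall a w, g (vscale a w) = vscale a (g w)].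

(* Vector bundle morphisms from [F] to the tangent bundle of [M], covering
   [eta]. *)
Definition tangent_bundle_morphism m n (M : manifold R m) (N : manifold R n) p
    (F : vectorBundle N p) (eta : N -> M)
    (rho : F -> (M -> R) -> R) : Prop :=
  [/\ forall w, tangent (eta (vproj w)) (rho w),
      forall v w f, vproj v = vproj w ->
        rho (vadd v w) f = rho v f + rho w f,
      forall a w f, rho (vscale a w) f = a * rho w f &
      forall f, smooth_fun f -> smooth_fun (fun w => rho w f)].

(* [anchor z] is the vector field Gamma(Th o rho, h o eta)(z) on N.  Its local
   expression [anchor_local] uses one coordinate system (x^i) for the
   components rho^i_alpha(q), taken at eta(q), and for the derivatives of
   f o h, taken at h^-1(q).  That the local expressions for the charts of the
   atlas agree is part of the structure; when the atlas of M is maximal, this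
   forces h^-1(q) = eta(q) wherever rho does not vanish.
   [bracket] and [anchor] are relevant only on smooth sections. *)
Record genLieAlgebroid m (M N : manifold R m) (h : diffeomorphism M N)
    (eta : diffeomorphism N M) p (F : vectorBundle N p) := GenLieAlgebroid {
  rho : F -> (M -> R) -> R;
  rho_morphism : tangent_bundle_morphism eta rho;
  anchor : (N -> F) -> N -> (N -> R) -> R;
  anchor_vf : forall z, smooth_section z -> vector_field (anchor z);
  anchor_linear : forall (f : N -> R) (z w : N -> F) q k, smooth_fun f ->
    smooth_section z -> smooth_section w ->
    anchor (sadd (sscale f z) w) q k = f q * anchor z q k + anchor w q k;
  anchor_local : forall (z : N -> F) (f : N -> R) (q : N)
      (t : trivialization F) (phi : chart R M m) (rhoq : 'M[R]_(p, m)),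
    smooth_section z -> smooth_fun f -> tdom t q ->
    atlas phi -> cdom phi (dinv h q) -> cdom phi (eta q) ->
    (forall alpha k, smooth_fun k ->
       rho (tframe t alpha q) k
       = \sum_i rhoq alpha i * partial phi i (eta q) k) ->
    anchor z q f
    = \sum_alpha \sum_i tcoord t (z q) 0 alpha * rhoq alpha i *
        partial phi i (dinv h q) (f \o h);
  bracket : (N -> F) -> (N -> F) -> N -> F;
  bracket_section : forall z w, smooth_section z -> smooth_section w ->
    smooth_section (bracket z w);
  bracket_linear : forall (c : R) z z' w,
    smooth_section z -> smooth_section z' -> smooth_section w ->
    bracket (sadd (sscale (cst c) z) z') w
    = sadd (sscale (cst c) (bracket z w)) (bracket z' w);
  bracket_antisym : forall z w, smooth_section z -> smooth_section w ->
    bracket w z = sscale (cst (-1)) (bracket z w);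
  bracket_jacobi : forall z1 z2 z3,
    smooth_section z1 -> smooth_section z2 -> smooth_section z3 ->
    sadd (bracket z1 (bracket z2 z3))
      (sadd (bracket z2 (bracket z3 z1)) (bracket z3 (bracket z1 z2)))
    = sscale (cst 0) z1;
  bracket_leibniz : forall z w (f : N -> R),
    smooth_section z -> smooth_section w -> smooth_fun f ->
    bracket z (sscale f w)
    = sadd (sscale f (bracket z w)) (sscale (fun q => anchor z q f) w);
  anchor_bracket : forall z w, smooth_section z -> smooth_section w ->
    anchor (bracket z w) = vf_bracket (anchor z) (anchor w) }.

(* The components of [g] at [x]: row [a], column [alpha] is g_a^alpha(x). *)
Definition components m n (M : manifold R m) (N : manifold R n) r p
    (E : vectorBundle M r) (F : vectorBundle N p) (h : M -> N) (g : E -> F)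
    (s : trivialization E) (t : trivialization F) (x : M) : 'M[R]_(r, p) :=
  \matrix_(a, alpha) tcoord t (g (tframe s a x)) 0 alpha.

(* On each chart the components of [g] have a two-sided inverse [gt], and
   [g'] : F -> E is the map (g^-1, h^-1) with components [gt]. *)
Definition local_inverse m n (M : manifold R m) (N : manifold R n) r p
    (E : vectorBundle M r) (F : vectorBundle N p) (h : M -> N) (g : E -> F)
    (g' : F -> E) : Prop :=
  forall (s : trivialization E) (t : trivialization F),
  exists gt : M -> 'M[R]_(p, r),
    (forall alpha b, smooth_fun_on (tdom s `&` h @^-1` tdom t)
       (fun x => gt x alpha b)) /\
    forall x, tdom s x -> tdom t (h x) ->
      [/\ components h g s t x *m gt x = 1%:M,
          gt x *m components h g s t x = 1%:M &
          forall c, g' (tpoint t (h x) c) = tpoint s x (c *m gt x)].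

(* Gamma(g, h) *)
Definition push m n (M : manifold R m) (N : manifold R n) r p
    (E : vectorBundle M r) (F : vectorBundle N p) (h : diffeomorphism M N)
    (g : E -> F) (u : M -> E) : N -> F := g \o u \o dinv h.

(* Gamma(g^-1, h^-1) *)
Definition pull m n (M : manifold R m) (N : manifold R n) r p
    (E : vectorBundle M r) (F : vectorBundle N p) (h : diffeomorphism M N)
    (g' : F -> E) (z : N -> F) : M -> E := g' \o z \o h.

(* Lambda^1(E, pi, M) *)
Definition one_form m (M : manifold R m) r (E : vectorBundle M r)
    (omega : (M -> E) -> M -> R) : Prop :=
  (forall v, smooth_section v -> smooth_fun (omega v)) /\
  (forall (f : M -> R) u v x, smooth_fun f ->
     smooth_section u -> smooth_section v ->
     omega (sadd (sscale f u) v) x = f x * omega u x + omega v x).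

Definition lie_derivative m (M N : manifold R m) (h : diffeomorphism M N)
    (eta : diffeomorphism N M) p (F : vectorBundle N p)
    (A : genLieAlgebroid h eta F) r (E : vectorBundle M r)
    (g : E -> F) (g' : F -> E) (u : M -> E)
    (omega : (M -> E) -> M -> R) : (M -> E) -> M -> R :=
  fun v x =>
    anchor A (push h g u) (h x) (omega v \o dinv h)
    - omega (pull h g' (bracket A (push h g u) (push h g v))) x.

(* [f] is locally y^a (omega_a o pi), where omega = omega_a s^a. *)
Definition is_hat m (M : manifold R m) r (E : vectorBundle M r)
    (omega : (M -> E) -> M -> R) (f : E -> R) : Prop :=
  forall s : trivialization E,
  exists omega_ : 'I_r -> M -> R,
    [/\ forall a, smooth_fun_on (tdom s) (omega_ a),
        forall v x, smooth_section v -> tdom s x ->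
          omega v x = \sum_a omega_ a x * tcoord s (v x) 0 a &
        forall w, tdom s (vproj w) ->
          f w = \sum_a tcoord s w 0 a * omega_ a (vproj w)].

(* The function characterized by [is_hat]; it exists and is unique for every
   one-form. *)
Definition hat m (M : manifold R m) r (E : vectorBundle M r)
    (omega : (M -> E) -> M -> R) : E -> R := xget (cst 0) (is_hat omega).

End Smoothness.

(* Main.v *)
Require Import Defs.
From mathcomp Require Import ring lra.
Set Implicit Arguments.
Unset Strict Implicit.
Unset Printing Implicit Defensive.
Local Open Scope classical_set_scope.
Local Open Scope ring_scope.

(** Conjugating by the diffeomorphism h turns the field on N attached to u into
    a vector field X on M ([base_field]).  The bracket of F, conjugated by
    (g, h), gives an operator L v = pull [push u, push v] on the sections of E
    ([lie_section]), and the Leibniz rule of the bracket makes it a derivation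
    over X: L (f v) = f L v + (X f) v.  With these, the Lie derivative is
    (L_u omega)(v) = X (omega v) - omega (L v); it is again a one-form.

    In coordinates x^i of M and fibre coordinates y^a of a frame s_a, put
    L s_b = Gamma_b^a s_a.  The hat of omega is y^a omega_a, so the hat of the
    Lie derivative is y^b X^i d_i omega_b - y^b Gamma_b^a omega_a: this is the
    image of y^a omega_a under
        X^i d/dx^i - y^b Gamma_b^a d/dy^a,
    a field that also projects to X.  It is the [local_lift], and
    [local_lift_is_lift] checks the two conditions at each point.

    Conversely a tangent vector of E is determined by its values on the
    coordinate functions x^i and y^a.  Near a point x^i is the pullback of a
    smooth function of M, hence of N, and y^a is the hat of a one-form, namely
    of a cut-off element of the dual frame.  So the two conditions leave at most
    one tangent vector at each point ([tangent_bundle_eq], [is_lift_unique]).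
    Existence is local and uniqueness is pointwise: the vectors chosen point by
    point agree near each point with a local lift, which gives the smoothness of
    the field.

    Everything global is tested on global functions, sections and one-forms, so
    local data have to be extended.  This uses bump functions ([bump]), made on
    R^n from exp(-1/t) and extended by zero to M, where they stay smooth because
    compact sets of a Hausdorff space are closed.  They give local frames of
    global sections ([local_frame]) and the fact that omega v at x depends only
    on v x ([one_form_frame]).

    Smoothness is handled pointwise: [Ck_at] asks for the partial derivatives
    near a point, and [smooth_at] for all orders.  The one analytic tool is the
    chain rule, which rests on the mean value theorem through [C1_slopes]. *)

(** * Functions of class C^k at a point *)

Section Calculus.
Variable R : realType.

(** Each condition holds in a neighbourhood of [x], of a size that may depend on
    [k]: this makes the notion local, and on an open set it is equivalent to
    [Ck] at all points ([Ck_atP]). *)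
Fixpoint Ck_at n k (f : 'rV[R]_n -> R) (x : 'rV[R]_n) : Prop :=
  (\forall y \near x, {for y, continuous f}) /\
  if k is k'.+1 then
    forall i : 'I_n,
      (\forall y \near x, derivable f y (delta_mx 0 i)) /\
      Ck_at k' (fun y => 'D_(delta_mx 0 i) f y) x
  else True.

Definition smooth_at n (f : 'rV[R]_n -> R) (x : 'rV[R]_n) := forall k, Ck_at k f x.

Lemma Ck_atP n k U (f : 'rV[R]_n -> R) : open U ->
  Ck k U f <-> forall x, U x -> Ck_at k f x.
Proof.
move=> oU; have nU x : U x -> \forall y \near x, U y by move=> Ux; exact: open_nbhs_nbhs.
elim: k f => [|k IH] f /=; split.
- by move=> [cf _] x /nU Ux; split=> //; apply: filterS Ux => y; exact: cf.
- by move=> H; split=> // x /H[/nbhs_singleton].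
- move=> [cf H] x Ux; split; first by apply: filterS (nU _ Ux) => y; exact: cf.
  move=> i; have [df Hf] := H i; split; last exact: (IH _).1 Hf _ Ux.
  by apply: filterS (nU _ Ux) => y; exact: df.
- move=> H; split=> [x /H[/nbhs_singleton]//|i]; split.
    by move=> x /H[_ /(_ i)[/nbhs_singleton]].
  by apply/IH => x /H[_ /(_ i)[]].
Qed.

Lemma CinfP n U (f : 'rV[R]_n -> R) : open U ->
  Cinf U f <-> forall x, U x -> smooth_at f x.
Proof.
move=> oU; split=> [H x Ux k|H k]; first exact: (Ck_atP _ _ oU).1 (H k) x Ux.
by apply/Ck_atP => // x Ux; exact: H.
Qed.

Lemma near_forall (T : topologicalType) (I : finType) (P : I -> T -> Prop) (x : T) :
  (forall i, \forall y \near x, P i y) -> \forall y \near x, forall i, P i y.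
Proof. by move=> H; exact: filter_forall. Qed.

Lemma near_eq_continuous (T U : topologicalType) (f g : T -> U) (y : T) :
  (\forall z \near y, f z = g z) -> {for y, continuous f} -> {for y, continuous g}.
Proof.
move=> fg; rewrite /prop_for /continuous_at -(nbhs_singleton fg) => cf.
apply: cvg_trans cf; apply: near_eq_cvg.
by apply: filterS fg => z ->.
Qed.

Lemma Ck_at_eq n k (f g : 'rV[R]_n -> R) (x : 'rV[R]_n) :
  (\forall y \near x, f y = g y) -> Ck_at k f x -> Ck_at k g x.
Proof.
elim: k f g => [|k IH] f g fg /= [cf H]; have fg2 := nbhs_interior fg;
  (split; first by apply: filterS2 fg2 cf => y; exact: near_eq_continuous) => //.
move=> i; have [df Hf] := H i; split.
  by apply: filterS2 fg2 df => y; exact: near_eq_derivable.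
by apply: IH Hf; apply: filterS fg2 => y; exact: near_eq_derive.
Qed.

Lemma Ck_at_near n k (f : 'rV[R]_n -> R) (x : 'rV[R]_n) :
  Ck_at k f x -> \forall y \near x, Ck_at k f y.
Proof.
elim: k f => [|k IH] f /= [cf H].
  by apply: filterS (nbhs_interior cf) => y; split.
pose P (i : 'I_n) (y : 'rV[R]_n) := (\forall z \near y, derivable f z (delta_mx 0 i)) /\
  Ck_at k (fun z => 'D_(delta_mx 0 i) f z) y.
have : \forall y \near x, forall i, P i y.
  apply: (@near_forall _ _ P) => i; have [df Hf] := H i.
  by apply: filterI; [exact: nbhs_interior|exact: IH].
by apply: filterS2 (nbhs_interior cf) => y; split.
Qed.

Lemma Ck_atS n k (f : 'rV[R]_n -> R) (x : 'rV[R]_n) : Ck_at k.+1 f x -> Ck_at k f x.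
Proof.
elim: k f => [|k IH] f [cf H]; first by split.
split=> // i; have [df Hf] := H i; split=> //; exact: IH Hf.
Qed.

Lemma Ck_at_cst n k (c : R) (x : 'rV[R]_n) : Ck_at k (fun=> c) x.
Proof.
elim: k c => [|k IH] c; (split; first by near=> y; exact: cst_continuous) => // i.
split; first by near=> y; exact: derivable_cst.
have -> : (fun y : 'rV[R]_n => 'D_(delta_mx 0 i) (fun=> c) y) = (fun=> 0).
  by apply/funext => y; exact: derive_cst.
exact: IH.
Unshelve. all: by end_near. Qed.

Lemma Ck_at_ncont n k (f : 'rV[R]_n -> R) (x : 'rV[R]_n) :
  Ck_at k f x -> \forall y \near x, {for y, continuous f}.
Proof. by case: k => [|k] []. Qed.

Lemma Ck_at_cont n k (f : 'rV[R]_n -> R) (x : 'rV[R]_n) :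
  Ck_at k f x -> {for x, continuous f}.
Proof. by case: k => [|k] [/nbhs_singleton]. Qed.

Lemma Ck_atD n k (f g : 'rV[R]_n -> R) (x : 'rV[R]_n) :
  Ck_at k f x -> Ck_at k g x -> Ck_at k (fun y => f y + g y) x.
Proof.
elim: k f g => [|k IH] f g /= [cf Hf] [cg Hg].
  by split=> //; apply: filterS2 cf cg => y cf cg; exact: continuousD.
split; first by apply: filterS2 cf cg => y cf cg; exact: continuousD.
move=> i; have [df {}Hf] := Hf i; have [dg {}Hg] := Hg i; split.
  by apply: filterS2 df dg => y df dg; exact: derivableD.
apply: Ck_at_eq (IH _ _ Hf Hg).
by apply: filterS2 df dg => y df dg; rewrite deriveD.
Qed.

Lemma Ck_atM n k (f g : 'rV[R]_n -> R) (x : 'rV[R]_n) :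
  Ck_at k f x -> Ck_at k g x -> Ck_at k (fun y => f y * g y) x.
Proof.
elim: k f g => [|k IH] f g.
  move=> /= [cf Hf] [cg Hg].
  by split=> //; apply: filterS2 cf cg => y cf cg; exact: continuousM.
move=> sf sg; have [cf Hf] := sf; have [cg Hg] := sg.
split; first by apply: filterS2 cf cg => y cf cg; exact: continuousM.
move=> i; have [df {}Hf] := Hf i; have [dg {}Hg] := Hg i; split.
  by apply: filterS2 df dg => y df dg; exact: derivableM.
apply: Ck_at_eq (Ck_atD (IH _ _ (Ck_atS sf) Hg) (IH _ _ (Ck_atS sg) Hf)).
by apply: filterS2 df dg => y df dg; rewrite deriveM.
Qed.

Lemma Ck_at_sum n k I (l : seq I) (f : I -> 'rV[R]_n -> R) (x : 'rV[R]_n) :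
  (forall i, Ck_at k (f i) x) -> Ck_at k (fun y => \sum_(i <- l) f i y) x.
Proof.
move=> H; elim: l => [|i l IH].
  apply: Ck_at_eq (Ck_at_cst k 0 x).
  by near=> y; rewrite big_nil.
apply: Ck_at_eq (Ck_atD (H i) IH).
by near=> y; rewrite big_cons.
Unshelve. all: by end_near. Qed.

Lemma derive_coord n (j : 'I_n) (x v : 'rV[R]_n) :
  is_derive x v (fun y : 'rV[R]_n => y 0 j : R) (v 0 j).
Proof.
have dI : derivable (@id 'rV[R]_n) x v by exact: derivable_id.
have d := (derivable_mxP _ _ _).1 dI 0 j.
split=> //.
have := derive_mx dI; rewrite derive_id => /matrixP/(_ 0 j).
by rewrite mxE => ->.
Qed.

Lemma Ck_at_coord n k (j : 'I_n) (x : 'rV[R]_n) : Ck_at k (fun y : 'rV[R]_n => y 0 j) x.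
Proof.
have cc : \forall y \near x, {for y, continuous (fun y : 'rV[R]_n => y 0 j)}.
  by near=> y; exact: coord_continuous.
case: k => [|k]; split=> // i; split.
  by near=> y; have [] := derive_coord j y (delta_mx 0 i).
apply: Ck_at_eq (Ck_at_cst k ((delta_mx 0 i : 'rV[R]_n) 0 j) x).
by near=> y; have [_ ->] := derive_coord j y (delta_mx 0 i).
Unshelve. all: by end_near. Qed.

End Calculus.

(** * The chain rule *)

Section ChainRule.
Variable R : realType.

Lemma derive_line n (f : 'rV[R]_n -> R) (v z : 'rV[R]_n) (s : R) :
  derivable f (s *: v + z) v ->
  is_derive s 1 (fun h : R => f (h *: v + z)) ('D_v f (s *: v + z)).
Proof.
have E : (fun h : R => h^-1 *: (f ((h *: 1 + s) *: v + z) - f (s *: v + z))) =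
         (fun h : R => h^-1 *: (f (h *: v + (s *: v + z)) - f (s *: v + z))).
  by apply/funext => h; rewrite [h *: 1]mulr1 scalerDl addrA.
by move=> df; split; rewrite /derivable /derive /= E.
Qed.

Lemma mvt_line n (f : 'rV[R]_n -> R) (v z : 'rV[R]_n) (a : R) :
  (forall s : R, `|s| <= `|a| -> derivable f (s *: v + z) v) ->
  exists2 c, `|c| <= `|a| & f (a *: v + z) - f z = 'D_v f (c *: v + z) * a.
Proof.
move=> df; pose g (h : R) := f (h *: v + z).
pose dg (h : R) := 'D_v f (h *: v + z).
have dgP (s : R) : `|s| <= `|a| -> is_derive s 1 g (dg s).
  by move=> sa; exact/derive_line/df.
have g0 : g 0 = f z by rewrite /g scale0r add0r.
have bnd (i : interval R) : (forall s, s \in i -> `|s| <= `|a|) ->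
    {within [set` i], continuous g}.
  by move=> ia; apply: derivable_within_continuous => s /ia /dgP[].
have [a0|a0] := leP 0 a.
  have Hs (s : R) : s \in `[0, a] -> `|s| <= `|a|.
    by rewrite in_itv /= => /andP[s0 sa]; rewrite !ger0_norm.
  have [|c c0a] := @MVT_segment _ g dg 0 a a0 _ (bnd _ Hs).
    by move=> s /subset_itv_oo_cc/Hs; exact: dgP.
  by rewrite g0 subr0 => E; exists c => //; exact: Hs.
have Hs (s : R) : s \in `[a, 0] -> `|s| <= `|a|.
  by rewrite in_itv /= => /andP[s0 sa]; rewrite !ler0_norm ?lerN2 // ltW.
have [|c c0a] := @MVT_segment _ g dg a 0 (ltW a0) _ (bnd _ Hs).
  by move=> s /subset_itv_oo_cc/Hs; exact: dgP.
rewrite g0 sub0r => E; exists c; first exact: Hs.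
by apply/oppr_inj; rewrite opprB E mulrN.
Qed.

(** Moving from [p] to [q] one coordinate at a time writes f q - f p as a sum of
    increments along the axes; [A i] is the slope of the i-th one, and the mean
    value theorem makes it a value of the i-th partial derivative at a point
    close to [p].  Continuity of the slopes at [p] then replaces
    differentiability in the proof of the chain rule. *)
Lemma C1_slopes n (f : 'rV[R]_n -> R) (p : 'rV[R]_n) : Ck_at 1 f p ->
  exists A : 'I_n -> 'rV[R]_n -> R,
    [/\ forall i, A i p = 'D_(delta_mx 0 i) f p,
        forall i, {for p, continuous (A i)} &
        forall q, f q - f p = \sum_i A i q * (q 0 i - p 0 i)].
Proof.
move=> [_ Hf].
pose path (q : 'rV[R]_n) k : 'rV[R]_n := \row_j (if (j < k)%N then q 0 j else p 0 j).
pose A (i : 'I_n) (q : 'rV[R]_n) := if q 0 i == p 0 i then 'D_(delta_mx 0 i) f p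
  else (f (path q i.+1) - f (path q i)) / (q 0 i - p 0 i).
have pathS q (i : 'I_n) : path q i.+1 = (q 0 i - p 0 i) *: delta_mx 0 i + path q i.
  apply/rowP => j; rewrite !mxE eqxx /= -val_eqE /= ltnS.
  case: ltngtP => /= [_|_|/val_inj ->]; rewrite ?mulr0 ?add0r ?mulr1 ?subrK //.
have Ap i : A i p = 'D_(delta_mx 0 i) f p by rewrite /A eqxx.
exists A; split=> //.
- move=> i; have [df [cd _]] := Hf i.
  move: df cd => /nbhs_ballP[d1 /= d10 df] /nbhs_singleton /= cd.
  rewrite /prop_for /continuous_at Ap.
  apply/(@cvgrPdist_le _ _ _ (nbhs p)) => e e0.
  move/(@cvgrPdist_le _ _ _ (nbhs p)) : cd => /(_ _ e0)/nbhs_ballP[d2 /= d20 cd].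
  apply/nbhs_ballP; exists (Num.min d1 d2); first by rewrite /= lt_min d10.
  move=> q [_ pq]; rewrite /A; case: eqP => [_|/eqP qpi].
    by rewrite subrr normr0 ltW.
  have near (d c : R) : Num.min d1 d2 <= d -> `|c| <= `|q 0 i - p 0 i| ->
      ball p d (c *: delta_mx 0 i + path q i).
    move=> md cq; split; first by rewrite (lt_le_trans _ md)// lt_min d10.
    move=> i0 j; rewrite ord1 !mxE eqxx /= -ball_normE /=.
    have /= := pq 0 j; rewrite -ball_normE /= => pqj.
    apply: lt_le_trans md; apply: le_lt_trans pqj.
    case: eqP => [->|_]; last first.
      by rewrite mulr0 add0r; case: ltnP => // _; rewrite subrr normr0.
    by rewrite ltnn mulr1 opprD addrCA subrr addr0 normrN distrC.
  rewrite pathS.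
  have [|c cq ->] := @mvt_line _ f (delta_mx 0 i) (path q i) (q 0 i - p 0 i).
    by move=> s sq; apply: df; apply: near => //; rewrite ge_min lexx.
  rewrite mulfK ?subr_eq0 //; apply: cd; apply: near => //.
  by rewrite ge_min lexx orbT.
- move=> q.
  have -> : f q - f p = f (path q n) - f (path q 0%N).
    by congr (f _ - f _); apply/rowP => j; rewrite mxE ?ltn_ord.
  rewrite -(telescope_sumr (fun k => f (path q k))) // big_mkord.
  apply: eq_bigr => i _; rewrite /A; case: eqP => [E|/eqP qpi].
    by rewrite pathS E !subrr scale0r add0r mulr0 subrr.
  by rewrite divfK // subr_eq0.
Qed.

(** The difference quotient of f o G is the sum over j of the quotient of G_j
    times a slope of f, and both factors converge. *)
Lemma chain_rule n k (f : 'rV[R]_n -> R) (G : 'rV[R]_k -> 'rV[R]_n) (x v : 'rV[R]_k) :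
  {for x, continuous G} ->
  (forall j, derivable (fun y => G y 0 j) x v) -> Ck_at 1 f (G x) ->
  is_derive x v (f \o G)
    (\sum_j 'D_v (fun y => G y 0 j) x * 'D_(delta_mx 0 j) f (G x)).
Proof.
move=> cG dG /C1_slopes[A [Ap Ac fE]].
have cl : (fun h : R => h *: v + x) @ 0^' --> x.
  apply: cvg_trans (_ : _ --> 0 *: v + x) _; last by rewrite scale0r add0r.
  apply: cvgD; last exact: cvg_cst.
  by apply: cvgZr_tmp; exact: nbhs_dnbhs.
suff L : h^-1 *: ((f \o G) (h *: v + x) - (f \o G) x) @[h --> 0^'] -->
    \sum_j 'D_v (fun y => G y 0 j) x * 'D_(delta_mx 0 j) f (G x).
  by split; [apply/cvg_ex; eexists; exact: L|apply: cvg_lim => //; exact: L].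
have -> : (fun h : R => h^-1 *: ((f \o G) (h *: v + x) - (f \o G) x)) =
    (fun h => \sum_j (h^-1 *: (G (h *: v + x) 0 j - G x 0 j)) * A j (G (h *: v + x))).
  apply/funext => h; rewrite /= fE scaler_sumr; apply: eq_bigr => j _.
  by rewrite -scalerAl mulrC.
apply: cvg_big => [|j _]; first exact: add_continuous. apply: cvgM; first exact: dG.
rewrite -Ap; apply: (cvg_comp _ (A j) _ (Ac j)).
exact: (cvg_comp _ G cl cG).
Qed.

Lemma continuous_mx (T : topologicalType) m n (G : T -> 'M[R]_(m, n)) (x : T) :
  (forall i j, {for x, continuous (fun y => G y i j)}) -> {for x, continuous G}.
Proof.
move=> cG; rewrite /prop_for /continuous_at => B [P GP sPB].
have : \forall y \near x, forall i j, P i j (G y i j).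
  by apply: near_forall => i; apply: near_forall => j; exact: cG (GP i j).
by apply: filterS => y; exact: sPB.
Qed.

Lemma continuous_rV (T : topologicalType) n (G : T -> 'rV[R]_n) (x : T) :
  (forall j, {for x, continuous (fun y => G y 0 j)}) -> {for x, continuous G}.
Proof. by move=> cG; apply: continuous_mx => i j; rewrite ord1. Qed.

Lemma Ck_at_comp n k l (f : 'rV[R]_n -> R) (G : 'rV[R]_k -> 'rV[R]_n) (x : 'rV[R]_k) :
  Ck_at l f (G x) -> (forall j, Ck_at l (fun y => G y 0 j) x) -> Ck_at l (f \o G) x.
Proof.
elim: l f => [|l IH] f sf sG.
  split=> //; have [cf _] := sf.
  have cG : {for x, continuous G} by apply: continuous_rV => j; exact: Ck_at_cont (sG j).
  have nf : \forall y \near x, {for G y, continuous f} := cG _ cf.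
  have : \forall y \near x, forall j, {for y, continuous (fun y => G y 0 j)}.
    by apply: near_forall => j; have [] := sG j.
  apply: filterS2 nf => y /= cfy cGy.
  by apply: continuous_comp => //; exact: continuous_rV.
have cG : {for x, continuous G} by apply: continuous_rV => j; exact: Ck_at_cont (sG j).
have sG' j := Ck_atS (sG j).
have nG : \forall y \near x, forall j, Ck_at l.+1 (fun y => G y 0 j) y.
  by apply: near_forall => j; exact: Ck_at_near.
have nf : \forall y \near x, Ck_at l.+1 f (G y) := cG _ (Ck_at_near sf).
have nd i : \forall y \near x, is_derive y (delta_mx 0 i) (f \o G)
    (\sum_j 'D_(delta_mx 0 i) (fun y => G y 0 j) y * 'D_(delta_mx 0 j) f (G y)).
  apply: filterS2 nf nG => y sfy sGy; apply: chain_rule.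
  - by apply: continuous_rV => j; exact: Ck_at_cont (sGy j).
  - by move=> j; have [_ /(_ i)[/nbhs_singleton]] := sGy j.
  - by elim: (l) sfy => // l' IH' /Ck_atS.
split; first exact: Ck_at_ncont (IH f (Ck_atS sf) sG').
move=> i; split; first by apply: filterS (nd i) => y [].
pose D y := \sum_j 'D_(delta_mx 0 i) (fun y => G y 0 j) y * 'D_(delta_mx 0 j) f (G y).
apply: (@Ck_at_eq _ _ _ D); first by apply: filterS (nd i) => y [_ ->].
apply: Ck_at_sum => j; apply: Ck_atM.
  by have [_ /(_ i)[]] := sG j.
by apply: (IH (fun z => 'D_(delta_mx 0 j) f z) _ sG'); have [_ /(_ j)[]] := sf.
Qed.

Lemma lsubmx_delta_l n k (j : 'I_n) :
  lsubmx (delta_mx 0 (lshift k j) : 'rV[R]_(n + k)) = delta_mx 0 j.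
Proof. by apply/rowP => i; rewrite !mxE eq_lshift. Qed.

Lemma lsubmx_delta_r n k (b : 'I_k) :
  lsubmx (delta_mx 0 (rshift n b) : 'rV[R]_(n + k)) = 0.
Proof. by apply/rowP => i; rewrite !mxE eq_lrshift andbF. Qed.

Lemma derive_lsubmx n k (f : 'rV[R]_n -> R) (y v : 'rV[R]_(n + k)) :
  'D_v (f \o lsubmx) y = 'D_(lsubmx v) f (lsubmx y).
Proof.
have e : (fun t : R => t^-1 *: (f (lsubmx (t *: v + y)) - f (lsubmx y))) =
    (fun t : R => t^-1 *: (f (t *: lsubmx v + lsubmx y) - f (lsubmx y))).
  apply/funext => t; congr (_ *: (f _ - _)).
  by apply/rowP => i; rewrite !mxE.
by rewrite /derive /= e.
Qed.

Lemma near_lsubmx n k (P : set 'rV[R]_n) (y : 'rV[R]_(n + k)) :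
  (\forall z \near lsubmx y, P z) -> \forall z \near y, P (lsubmx z).
Proof.
move=> nP.
have c : {for y, continuous (@lsubmx R 1 n k)}.
  by apply: differentiable_continuous; exact: differentiable_lsubmx.
exact: (c _ nP).
Qed.

End ChainRule.

(** * Bump functions on R^n *)

Section Bump.
Variable R : realType.

(** t^(-k) exp(-1/t) for t > 0.  All k are needed at once because the derivative
    of one member of the family is a combination of two others. *)
Definition flat k (t : R) : R := if 0 < t then t^-1 ^+ k * expR (- t^-1) else 0.

Lemma exprn_le_expR k :
  exists2 C : R, 0 < C & forall t : R, 0 <= t -> t ^+ k <= C * expR t.
Proof.
(* t / k <= exp (t / k), raised to the k-th power *)
case: k => [|k].
  by exists 1 => // t t0; rewrite expr0 mul1r -expR0 ler_expR.
exists (k.+1%:R ^+ k.+1); first by rewrite exprn_gt0 // ltr0n.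
move=> t t0.
have -> : expR t = expR (t / k.+1%:R) ^+ k.+1.
  by rewrite -expRM_natl -mulr_natl mulrCA divff ?mulr1 // pnatr_eq0.
rewrite -exprMn; apply: lerXn2r; rewrite ?nnegrE // ?mulr_ge0 ?expR_ge0 ?ler0n //.
rewrite -ler_pdivrMl ?ltr0n // mulrC.
apply: le_trans (expR_ge1Dx _); by rewrite lerDr ler01.
Qed.

(** The quadratic bound gives the derivative 0 at the origin. *)
Lemma flat_bound k : exists2 C : R, 0 < C & forall t, `|flat k t| <= C * t ^+ 2.
Proof.
have [C C0 CP] := exprn_le_expR k.+2; exists C => // t; rewrite /flat.
case: ifPn => [t0|_]; last by rewrite normr0 mulr_ge0 ?sqr_ge0 // ltW.
have ti0 : 0 <= t^-1 by rewrite invr_ge0 ltW.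
rewrite ger0_norm ?mulr_ge0 ?exprn_ge0 ?expR_ge0 //.
have := CP _ ti0; rewrite -addn2 exprD => H.
rewrite expRN ler_pdivrMr ?expR_gt0 // mulrAC.
have -> : t^-1 ^+ k = t^-1 ^+ k * t^-1 ^+ 2 * t ^+ 2.
  by rewrite -mulrA -exprMn mulVf ?gt_eqF // expr1n mulr1.
by rewrite ler_pM2r // exprn_gt0.
Qed.

Lemma flat_derive k (t : R) : is_derive t 1 (flat k) (flat k.+2 t - k%:R * flat k.+1 t).
Proof.
have [t0|t0|->] := ltgtP t 0.
- have -> : flat k.+2 t - k%:R * flat k.+1 t = 0.
    by rewrite /flat ltNge ltW //= mulr0 subrr.
  apply: near_eq_is_derive (is_derive_cst (0 : R) t 1).
  by apply: filterS (lt_nbhsl t0) => x x0; rewrite /flat ltNge ltW.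
- have d1 : is_derive t 1 (fun x : R => x^-1) (- t ^- 2 *: 1).
    by apply: (@is_deriveV _ id); rewrite gt_eqF.
  have := is_deriveM (is_deriveX k d1)
    (is_derive1_comp (is_derive_expR _) (is_deriveN d1)).
  set D := (X in is_derive _ _ _ X).
  have -> : flat k.+2 t - k%:R * flat k.+1 t = D.
    rewrite /D /flat t0 /GRing.scale /= !fctE -!exprVn; set v := t^-1; set e := expR _.
    by case: (k) => [|k'] /=; rewrite ?exprS; ring.
  apply: near_eq_is_derive.
  by apply: filterS (lt_nbhsr t0) => x x0; rewrite /flat x0 /= !fctE.
- have [C C0 Cb] := flat_bound k.
  rewrite {2 3}/flat ltxx mulr0 subr0.
  have z0 : flat k 0 = 0 by rewrite /flat ltxx.
  suff L : h^-1 *: (flat k (h *: 1 + 0) - flat k 0) @[h --> (0:R)^'] --> (0 : R).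
    by split; [apply/cvg_ex; exists 0; exact: L|apply: cvg_lim => //; exact: L].
  apply/cvgrPdist_le => e e0; near=> h.
  rewrite sub0r normrN z0 subr0 addr0 [h *: 1]mulr1 normrM normfV.
  have h0 : h != 0 by near: h; exact: nbhs_dnbhs_neq.
  rewrite ler_pdivrMl ?normr_gt0 //; apply: le_trans (Cb _) _.
  rewrite -real_normK ?num_real // expr2 mulrCA ler_pM2l ?normr_gt0 //.
  rewrite -ler_pdivlMl // mulrC.
  by near: h; apply: dnbhs0_le; rewrite divr_gt0.
Unshelve. all: by end_near. Qed.

Lemma Ck_at_flat n l k (s : 'rV[R]_n -> R) x :
  Ck_at l s x -> Ck_at l (fun y => flat k (s y)) x.
Proof.
move=> ss; pose G y : 'rV[R]_1 := const_mx (s y).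
apply: (@Ck_at_eq _ _ _ ((fun z : 'rV[R]_1 => flat k (z 0 0)) \o G)).
  by near=> y; rewrite /= mxE.
apply: Ck_at_comp; last first.
  by move=> j; apply: Ck_at_eq ss; near=> y; rewrite mxE.
have fd k' (z : 'rV[R]_1) : is_derive z (delta_mx 0 0) (fun z => flat k' (z 0 0))
   (flat k'.+2 (z 0 0) - k'%:R * flat k'.+1 (z 0 0)).
  have [d dE] := flat_derive k' (z 0 0).
  have E : (fun h : R => h^-1 *: (flat k' (h *: 1 + z 0 0) - flat k' (z 0 0))) =
      (fun h => h^-1 *: (flat k' ((h *: delta_mx 0 0 + z) 0 0) - flat k' (z 0 0))).
    by apply/funext => h; rewrite !mxE /= mulr1 [h *: 1]mulr1.
  by split; rewrite ?/derivable ?/derive /= -?E //; exact: dE.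
elim: l k (G x) {ss} => [|l IH] k' z.
  split=> //; near=> z'.
  apply: (@continuous_comp _ _ _ (fun z : 'rV[R]_1 => z 0 0) (flat k')).
    exact: coord_continuous.
  apply/differentiable_continuous/derivable1_diffP.
  by have [] := flat_derive k' (z' 0 0).
split; first exact: Ck_at_ncont (IH k' z).
move=> i; rewrite ord1; split; first by near=> z'; have [] := fd k' z'.
pose D (z : 'rV[R]_1) := flat k'.+2 (z 0 0) + (- k'%:R) * flat k'.+1 (z 0 0).
apply: (@Ck_at_eq _ _ _ D); first by near=> z'; have [_ ->] := fd k' z'; rewrite /D mulNr.
by apply: Ck_atD; [exact: IH|apply: Ck_atM; [exact: Ck_at_cst|exact: IH]].
Unshelve. all: by end_near. Qed.

(** With f = flat 0 and c = f 1, the function t |-> f (c - f t) / f c is 1 for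
    t <= 0, where f t = 0, and vanishes for t >= 1, where f t >= c.  Composing it
    with a quadratic function centred at [a] avoids any quotient of functions. *)
Lemma bump_rV n (a : 'rV[R]_n) (e : R) : 0 < e ->
  exists chi : 'rV[R]_n -> R, exists2 K : set 'rV[R]_n,
    compact K & [/\ K `<=` ball a e, forall x, smooth_at chi x,
    (\forall x \near a, chi x = 1) & forall x, ~ K x -> chi x = 0].
Proof.
move=> e0.
pose d := e / 2; have d0 : 0 < d by rewrite divr_gt0.
pose c := flat 0 1; have c0 : 0 < c by rewrite /c /flat ltr01 expr0 mul1r expR_gt0.
have fc0 : flat 0 c != 0 by rewrite /flat c0 expr0 mul1r gt_eqF // expR_gt0.
(* s is -1 at a, and at least 1 where some coordinate of x - a exceeds d *)
pose s (x : 'rV[R]_n) := \sum_i ((x 0 i - a 0 i) * (x 0 i - a 0 i)) * (2 / d ^+ 2) + (-1).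
pose chi x := (flat 0 c)^-1 * flat 0 (c + (-1) * flat 0 (s x)).
have ss l x : Ck_at l s x.
  apply: Ck_atD; last exact: Ck_at_cst.
  apply: Ck_at_sum => i; apply: Ck_atM; last exact: Ck_at_cst.
  by apply: Ck_atM; apply: Ck_atD; (exact: Ck_at_cst || exact: Ck_at_coord).
exists chi, [set x | forall i, x ord0 i \in `[a 0 i - d, a 0 i + d]].
  apply: (@rV_compact _ _ (fun i => `[a 0 i - d, a 0 i + d]%classic)) => i.
  exact: segment_compact.
split.
- move=> x Kx; split=> // i j; rewrite ord1 -ball_normE /=.
  have := Kx j; rewrite in_itv /= => H.
  apply: (@le_lt_trans _ _ d); last by rewrite /d ltr_pdivrMr // ltr_pMr // ltr1n.
  by rewrite ler_norml; move: H; move: (x _ _) (a _ _) => u v; lra.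
- move=> x l; apply: Ck_atM; first exact: Ck_at_cst.
  apply: Ck_at_flat; apply: Ck_atD; first exact: Ck_at_cst.
  by apply: Ck_atM; [exact: Ck_at_cst|exact: Ck_at_flat].
- have sa : s a < 0.
    by rewrite /s big1 ?add0r ?ltrN10 // => i _; rewrite subrr !mul0r.
  have ns : \forall x \near a, s x < 0 := Ck_at_cont (ss 0%N a) (lt_nbhsl sa).
  apply: filterS ns => x sx; rewrite /chi {3}/flat ltNge (ltW sx) /= mulr0 addr0.
  by rewrite mulVf.
- move=> x Kx; rewrite /chi.
  suff s1 : 1 <= s x.
    have : c <= flat 0 (s x).
      rewrite /c /flat ltr01 (lt_le_trans ltr01 s1) !expr0 !mul1r ler_expR lerN2.
      by rewrite invr1 invf_le1 ?(lt_le_trans ltr01).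
    move: (flat 0 (s x)) => w cw; have -> : flat 0 (c + -1 * w) = 0.
      by rewrite /flat mulN1r subr_gt0 ltNge cw.
    by rewrite mulr0.
  have [i ni] : exists i, ~~ (x ord0 i \in `[a 0 i - d, a 0 i + d]).
    apply: contrapT => H; apply: Kx => i; apply: contrapT => /negP ni.
    by apply: H; exists i.
  rewrite /s (bigD1 i) //=.
  have : 0 <= \sum_(j | j != i) ((x 0 j - a 0 j) * (x 0 j - a 0 j)) * (2 / d ^+ 2).
    by apply: sumr_ge0 => j _; rewrite mulr_ge0 -?expr2 ?sqr_ge0 // divr_ge0 // sqr_ge0.
  have : 2 <= (x 0 i - a 0 i) * (x 0 i - a 0 i) * (2 / d ^+ 2).
    rewrite mulrCA ler_pMr // ler_pdivlMr ?exprn_gt0 // mul1r.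
    move: ni; rewrite in_itv /=; move: (x _ _) (a _ _) d0 => u v; clear.
    move=> d0; rewrite negb_and -!ltNge => /orP[] H; nra.
  lra.
Qed.

End Bump.

(** * Smoothness at a point of a manifold *)

Section SmoothAt.
Variables (R : realType) (n : nat).
Implicit Types (f g : 'rV[R]_n -> R) (x : 'rV[R]_n).

Lemma smooth_at_eq f g x :
  (\forall y \near x, f y = g y) -> smooth_at f x -> smooth_at g x.
Proof. by move=> fg sf k; exact: Ck_at_eq (sf k). Qed.

Lemma smooth_at_comp m (f : 'rV[R]_m -> R) (G : 'rV[R]_n -> 'rV[R]_m) x :
  smooth_at f (G x) -> (forall j, smooth_at (fun y => G y 0 j) x) ->
  smooth_at (f \o G) x.
Proof. by move=> sf sG k; apply: Ck_at_comp => // j; exact: sG. Qed.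

Lemma smooth_at_cont f x : smooth_at f x -> {for x, continuous f}.
Proof. by move=> /(_ 0%N); exact: Ck_at_cont. Qed.

Lemma smooth_at_derivable f x i : smooth_at f x -> derivable f x (delta_mx 0 i).
Proof. by move=> /(_ 1%N)[_ /(_ i)[/nbhs_singleton]]. Qed.

Lemma smooth_at_partial f x i :
  smooth_at f x -> smooth_at (fun y => 'D_(delta_mx 0 i) f y) x.
Proof. by move=> sf k; have [_ /(_ i)[]] := sf k.+1. Qed.

End SmoothAt.

Section Charts.
Variables (R : realType) (T : topologicalType) (n : nat) (phi : chart R T n).

Lemma near_cdom x : cdom phi x -> \forall y \near x, cdom phi y.
Proof. by move=> xd; apply: open_nbhs_nbhs; split=> //; exact: cdom_open. Qed.

Lemma near_cinv (P : set T) x : cdom phi x -> (\forall y \near x, P y) ->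
  \forall z \near cmap phi x,
    [/\ P (cinv phi z), cdom phi (cinv phi z) & cmap phi (cinv phi z) = z].
Proof.
move=> xd Px.
have im : (cmap phi @` cdom phi) (cmap phi x) by exists x.
have cP : \forall z \near cmap phi x, P (cinv phi z).
  by apply: (cinv_cont im); rewrite cmapK.
have nim : \forall z \near cmap phi x, (cmap phi @` cdom phi) z.
  by apply: open_nbhs_nbhs; split=> //; exact: ccod_open.
by apply: filterS2 cP nim => z Pz [y yd yz]; rewrite -{2 3}yz !cmapK.
Qed.

Lemma near_cmap (P : set 'rV[R]_n) x : cdom phi x ->
  (\forall z \near cmap phi x, P z) -> \forall y \near x, P (cmap phi y).
Proof. by move=> xd Pz; exact: (cmap_cont xd). Qed.

Lemma open_cmap_image (A : set T) : open A -> open (cmap phi @` (A `&` cdom phi)).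
Proof.
move=> oA; rewrite openE => _ [x [Ax xd] <-].
have nA : \forall y \near x, A y by exact: open_nbhs_nbhs.
by apply: filterS (near_cinv xd nA) => z [Az zd zE]; exists (cinv phi z).
Qed.

End Charts.

Section Manifolds.
Variable R : realType.

(** Smoothness at a point, for functions on a manifold, for parametrizations
    R^n -> M and for maps of manifolds.  One chart is enough in the source,
    because the change of charts is smooth; in the target all charts occur, and
    continuity near the point keeps the image in their domains. *)
Definition smooth_atM m (M : manifold R m) (f : M -> R) (x : M) : Prop :=
  exists2 phi : chart R M m, atlas phi /\ cdom phi x &
    smooth_at (f \o cinv phi) (cmap phi x).

Definition smooth_atRM n m (M : manifold R m)
    (G : 'rV[R]_n -> M) (y : 'rV[R]_n) : Prop :=
  (\forall z \near y, {for z, continuous G}) /\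
  forall psi : chart R M m, atlas psi -> cdom psi (G y) ->
    forall j, smooth_at (fun z => cmap psi (G z) 0 j) y.

Definition smooth_atMM m n (M : manifold R m) (N : manifold R n)
    (H : M -> N) (x : M) : Prop :=
  exists2 phi : chart R M m, atlas phi /\ cdom phi x &
    smooth_atRM (H \o cinv phi) (cmap phi x).

(** This is the compatibility of the charts of the atlas. *)
Lemma smooth_at_cinv m (M : manifold R m) (phi : chart R M m) (x : M) :
  atlas phi -> cdom phi x -> smooth_atRM (cinv phi) (cmap phi x).
Proof.
move=> aphi xd; split.
  have : \forall z \near cmap phi x, (cmap phi @` cdom phi) z.
    by apply: open_nbhs_nbhs; split; [exact: ccod_open|exists x].
  by apply: filterS => z; exact: cinv_cont.
move=> psi apsi; rewrite cmapK // => xpsi j.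
have oU : open (cmap phi @` (cdom phi `&` cdom psi)).
  by rewrite setIC; exact: open_cmap_image (cdom_open psi).
have := (CinfP _ oU).1 (atlas_compat aphi apsi j); apply.
by exists x.
Qed.

Lemma smooth_at_RMR n m (M : manifold R m) (G : 'rV[R]_n -> M) (f : M -> R) y :
  smooth_atRM G y -> smooth_atM f (G y) -> smooth_at (f \o G) y.
Proof.
move=> [cG sG] [psi [apsi psiy] sf].
have Gd : \forall z \near y, cdom psi (G z) := nbhs_singleton cG _ (near_cdom psiy).
apply: (@smooth_at_eq _ _ ((f \o cinv psi) \o (cmap psi \o G))).
  by apply: filterS Gd => z zd /=; rewrite cmapK.
by apply: smooth_at_comp => // j; exact: sG.
Qed.

Lemma smooth_atM_chart m (M : manifold R m) (f : M -> R) (x : M) (phi : chart R M m) :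
  atlas phi -> cdom phi x -> smooth_atM f x -> smooth_at (f \o cinv phi) (cmap phi x).
Proof.
move=> aphi xd sf; apply: smooth_at_RMR; first exact: smooth_at_cinv.
by rewrite cmapK.
Qed.

Lemma smooth_atMM_cont m n (M : manifold R m) (N : manifold R n) (H : M -> N) (x : M) :
  smooth_atMM H x -> \forall y \near x, {for y, continuous H}.
Proof.
move=> [phi [aphi xd] [cH _]].
apply: filterS2 (near_cmap xd cH) (near_cdom xd) => y cHy yd.
apply: (@near_eq_continuous _ _ ((H \o cinv phi) \o cmap phi)).
  by apply: filterS (near_cdom yd) => z zd /=; rewrite cmapK.
by apply: continuous_comp => //; exact: cmap_cont.
Qed.

Lemma smooth_at_RMM n m k (M : manifold R m) (N : manifold R k)
    (G : 'rV[R]_n -> M) (H : M -> N) y :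
  smooth_atRM G y -> smooth_atMM H (G y) -> smooth_atRM (H \o G) y.
Proof.
move=> sG sH; have cG := sG.1; split.
  have cH : \forall z \near y, {for G z, continuous H} :=
    nbhs_singleton cG _ (smooth_atMM_cont sH).
  by apply: filterS2 cH cG => z cH cGz; exact: continuous_comp.
move=> psi apsi Hd j.
apply: (@smooth_at_RMR _ _ _ G (fun w => cmap psi (H w) 0 j)) => //.
have [phi [aphi phid] [_ sHphi]] := sH; exists phi => //.
by apply: (sHphi psi apsi) => /=; rewrite cmapK.
Qed.

Lemma smooth_at_RRM n k m (M : manifold R m) (b : 'rV[R]_n -> 'rV[R]_k)
    (G : 'rV[R]_k -> M) y :
  (forall j, smooth_at (fun z => b z 0 j) y) -> smooth_atRM G (b y) ->
  smooth_atRM (G \o b) y.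
Proof.
move=> sb [cG sG].
have nb : \forall z \near y, {for z, continuous b}.
  have : \forall z \near y, forall j, {for z, continuous (fun z => b z 0 j)}.
    by apply: near_forall => j; exact: Ck_at_ncont (sb j 0%N).
  by apply: filterS => z; exact: continuous_rV.
split.
  have cGb : \forall z \near y, {for b z, continuous G} := nbhs_singleton nb _ cG.
  by apply: filterS2 cGb nb => z cGz cbz; exact: continuous_comp.
move=> psi apsi Gd j.
by apply: (@smooth_at_comp _ _ _ (fun w => cmap psi (G w) 0 j) b) => //; exact: sG.
Qed.

Lemma smooth_at_MMR m n (M : manifold R m) (N : manifold R n)
    (H : M -> N) (f : N -> R) x :
  smooth_atMM H x -> smooth_atM f (H x) -> smooth_atM (f \o H) x.
Proof.
move=> [phi [aphi xd] sH] sf; exists phi => //.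
by apply: (smooth_at_RMR sH); rewrite /= cmapK.
Qed.

Lemma smooth_at_MMM m n k (M : manifold R m) (N : manifold R n) (P : manifold R k)
    (H : M -> N) (K : N -> P) x :
  smooth_atMM H x -> smooth_atMM K (H x) -> smooth_atMM (K \o H) x.
Proof.
move=> [phi [aphi xd] sH] sK; exists phi => //.
by apply: (smooth_at_RMM sH); rewrite /= cmapK.
Qed.

Lemma smooth_at_MRM m k n (M : manifold R m) (N : manifold R n) (a : M -> 'rV[R]_k)
    (G : 'rV[R]_k -> N) x :
  (forall j, smooth_atM (fun y => a y 0 j) x) -> smooth_atRM G (a x) ->
  smooth_atMM (G \o a) x.
Proof.
move=> sa sG; have [phi aphi xd] := atlas_cover x; exists phi => //.
apply: (@smooth_at_RRM _ _ _ _ (a \o cinv phi)); last by rewrite /= cmapK.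
by move=> j; exact: smooth_atM_chart (sa j).
Qed.

Lemma smooth_at_MRR m k (M : manifold R m) (a : M -> 'rV[R]_k) (f : 'rV[R]_k -> R) x :
  (forall j, smooth_atM (fun y => a y 0 j) x) -> smooth_at f (a x) ->
  smooth_atM (f \o a) x.
Proof.
move=> sa sf; have [phi aphi xd] := atlas_cover x; exists phi => //.
apply: (@smooth_at_comp _ _ _ f (a \o cinv phi)); first by rewrite /= cmapK.
by move=> j; exact: smooth_atM_chart (sa j).
Qed.

Lemma smooth_at_cmap m (M : manifold R m) (phi : chart R M m) (x : M) j :
  atlas phi -> cdom phi x -> smooth_atM (fun y => cmap phi y 0 j) x.
Proof.
move=> aphi xd; exists phi => //.
apply: (@smooth_at_eq _ _ (fun z => z 0 j)); last by move=> k; exact: Ck_at_coord.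
by apply: filterS (near_cinv xd (near_cdom xd)) => z [_ _ /= ->].
Qed.

Section Functions.
Variables (m : nat) (M : manifold R m).
Implicit Types (f g : M -> R) (x : M).

Lemma smooth_atM_eq f g x :
  (\forall y \near x, f y = g y) -> smooth_atM f x -> smooth_atM g x.
Proof.
move=> fg [phi [aphi xd] sf]; exists phi => //; apply: smooth_at_eq sf.
by apply: filterS (near_cinv xd fg) => z [].
Qed.

Lemma smooth_atM_cst (c : R) x : smooth_atM (fun=> c) x.
Proof.
have [phi aphi xd] := atlas_cover x; exists phi => // k; exact: Ck_at_cst.
Qed.

Lemma smooth_atMD f g x : smooth_atM f x -> smooth_atM g x ->
  smooth_atM (fun y => f y + g y) x.
Proof.
move=> sf sg; have [phi aphi xd] := atlas_cover x; exists phi => // k.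
by apply: Ck_atD; exact: smooth_atM_chart.
Qed.

Lemma smooth_atM_mul f g x : smooth_atM f x -> smooth_atM g x ->
  smooth_atM (fun y => f y * g y) x.
Proof.
move=> sf sg; have [phi aphi xd] := atlas_cover x; exists phi => // k.
by apply: Ck_atM; exact: smooth_atM_chart.
Qed.

Lemma smooth_atM_sum I (l : seq I) (f : I -> M -> R) x :
  (forall i, smooth_atM (f i) x) -> smooth_atM (fun y => \sum_(i <- l) f i y) x.
Proof.
move=> sf; have [phi aphi xd] := atlas_cover x; exists phi => // k.
by apply: (@Ck_at_sum _ _ _ _ _ (fun i => f i \o cinv phi)) => i; exact: smooth_atM_chart.
Qed.

Lemma smooth_fun_onP (A : set M) f : open A ->
  smooth_fun_on A f <-> forall x, A x -> smooth_atM f x.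
Proof.
move=> oA; split=> [sf x Ax|sf phi aphi].
  have [phi aphi xd] := atlas_cover x; exists phi => //.
  have := (CinfP _ (open_cmap_image oA)).1 (sf _ aphi); apply.
  by exists x.
apply/CinfP; first exact: open_cmap_image.
by move=> _ [x [Ax xd] <-]; apply: smooth_atM_chart => //; exact: sf.
Qed.

Lemma smooth_funP f : smooth_fun f <-> forall x, smooth_atM f x.
Proof.
split=> [sf x|sf]; first exact: (smooth_fun_onP _ openT).1 sf x I.
by apply/(smooth_fun_onP _ openT).
Qed.

End Functions.

Lemma smooth_from_onP n m (M : manifold R m) (A : set 'rV[R]_n) (G : 'rV[R]_n -> M) :
  open A -> smooth_from_on A G <-> forall y, A y -> smooth_atRM G y.
Proof.
move=> oA.
have nA y : A y -> \forall z \near y, A z by move=> Ay; exact: open_nbhs_nbhs.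
have oAG (psi : chart R M m) : (forall y, A y -> {for y, continuous G}) ->
    open (A `&` G @^-1` cdom psi).
  move=> cG; rewrite openE => y [Ay Gy]; apply: filterI; first exact: nA.
  exact: (cG y Ay _ (near_cdom Gy)).
split=> [[cG sG] y Ay|sG].
  split; first by apply: filterS (nA _ Ay) => z; exact: cG.
  move=> psi apsi Gd j.
  by have := (CinfP _ (oAG psi cG)).1 (sG psi apsi j); apply.
have cG y : A y -> {for y, continuous G} by move=> /sG[/nbhs_singleton].
split=> // psi apsi j; apply/CinfP; first exact: oAG.
by move=> y [Ay Gd]; exact: (sG y Ay).2.
Qed.

Lemma smooth_mapP m n (M : manifold R m) (N : manifold R n) (H : M -> N) :
  smooth_map H <-> forall x, smooth_atMM H x.
Proof.
split=> [sH x|sH phi aphi].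
  have [phi aphi xd] := atlas_cover x; exists phi => //.
  have := (smooth_from_onP _ (@ccod_open _ _ _ phi)).1 (sH _ aphi); apply.
  by exists x.
apply/smooth_from_onP; first exact: ccod_open.
move=> _ [x xd <-]; apply: smooth_at_RMM; first exact: smooth_at_cinv.
by rewrite cmapK.
Qed.

Lemma smooth_fun_cst m (M : manifold R m) (c : R) : smooth_fun (cst c : M -> R).
Proof. by apply/smooth_funP => x; exact: smooth_atM_cst. Qed.

Lemma smooth_fun_at m (M : manifold R m) (f : M -> R) x : smooth_fun f -> smooth_atM f x.
Proof. by move=> /smooth_funP. Qed.

Lemma smooth_map_at m n (M : manifold R m) (N : manifold R n) (H : M -> N) x :
  smooth_map H -> smooth_atMM H x.
Proof. by move=> /smooth_mapP. Qed.

Lemma smooth_fun_comp m n (M : manifold R m) (N : manifold R n)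
    (H : M -> N) (f : N -> R) :
  smooth_map H -> smooth_fun f -> smooth_fun (f \o H).
Proof.
move=> /smooth_mapP sH /smooth_funP sf; apply/smooth_funP => x.
exact: smooth_at_MMR.
Qed.

Lemma smooth_map_comp m n k (M : manifold R m) (N : manifold R n) (P : manifold R k)
    (H : M -> N) (K : N -> P) :
  smooth_map H -> smooth_map K -> smooth_map (K \o H).
Proof.
move=> /smooth_mapP sH /smooth_mapP sK; apply/smooth_mapP => x.
exact: smooth_at_MMM.
Qed.

Lemma smooth_map_continuous m n (M : manifold R m) (N : manifold R n) (H : M -> N) :
  smooth_map H -> continuous H.
Proof. by move=> /smooth_mapP sH x; have /nbhs_singleton := smooth_atMM_cont (sH x). Qed.

(** A bump function of the chart, extended by zero.  Its support is the image of
    a compact set, hence closed because M is Hausdorff, and so the extension is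
    smooth across the boundary of the chart. *)
Lemma bump m (M : manifold R m) (x0 : M) (U : set M) : open U -> U x0 ->
  exists chi : M -> R, exists2 K : set M,
    [/\ closed K, K `<=` U & forall x, ~ K x -> chi x = 0] &
    smooth_fun chi /\ \forall x \near x0, chi x = 1.
Proof.
move=> oU Ux0; have [phi aphi xd] := atlas_cover x0.
have : nbhs (cmap phi x0) (cmap phi @` (U `&` cdom phi)).
  by apply: open_nbhs_nbhs; split; [exact: open_cmap_image|exists x0].
move=> /nbhs_ballP[e /= e0 eU].
have [chi [K cK [Ke schi chi1 chi0]]] := bump_rV (cmap phi x0) e0.
pose X x := if `[< cdom phi x >] then chi (cmap phi x) else 0.
have cd x : cdom phi x -> X x = chi (cmap phi x) by move=> xd'; rewrite /X asboolT.
have K'0 x : ~ (cinv phi @` K) x -> X x = 0.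
  move=> Kx; rewrite /X; case: asboolP => // xd'; apply: chi0 => Kx'.
  by apply: Kx; exists (cmap phi x) => //; rewrite cmapK.
have clK : closed (cinv phi @` K).
  apply: compact_closed; first exact: m_hausdorff.
  apply: continuous_compact => //; apply: continuous_in_subspaceT => y.
  rewrite inE => /Ke/eU[x [_ xd'] <-]; apply: cinv_cont; by exists x.
exists X, (cinv phi @` K); first split=> //.
  by move=> _ [y /Ke/eU[x [Ux xd'] <-] <-]; rewrite cmapK.
split; last first.
  by apply: filterS2 (near_cmap xd chi1) (near_cdom xd) => x xE xd'; rewrite cd.
apply/smooth_funP => x.
have [xd'|xd'] := pselect (cdom phi x).
  apply: (@smooth_atM_eq _ _ (chi \o cmap phi)).
    by apply: filterS (near_cdom xd') => y yd; rewrite cd.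
  by apply: smooth_at_MRR => // j; exact: smooth_at_cmap.
apply: (@smooth_atM_eq _ _ (fun=> 0)); last exact: smooth_atM_cst.
have : nbhs x (~` (cinv phi @` K)).
  apply: open_nbhs_nbhs; split; first exact: closed_openC.
  move=> [y /Ke/eU[z [_ zd] <-]]; rewrite cmapK // => zx; by apply: xd'; rewrite -zx.
by apply: filterS => y /K'0 ->.
Qed.

(** The product vanishes on the complement of [K], which is open and
    together with [U] covers M. *)
Lemma smooth_fun_cutoff m (M : manifold R m) (K U : set M) (chi f : M -> R) :
  closed K -> K `<=` U -> (forall x, ~ K x -> chi x = 0) -> smooth_fun chi ->
  (forall x, U x -> smooth_atM f x) -> smooth_fun (fun x => chi x * f x).
Proof.
move=> cK KU chi0 /smooth_funP schi sf; apply/smooth_funP => x.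
have [/KU Ux|Kx] := pselect (K x); first by apply: smooth_atM_mul => //; exact: sf.
apply: (@smooth_atM_eq _ _ (fun=> 0)); last exact: smooth_atM_cst.
have : nbhs x (~` K) by apply: open_nbhs_nbhs; split=> //; exact: closed_openC.
by apply: filterS => y /chi0 ->; rewrite mul0r.
Qed.

Lemma smooth_fun_extend m (M : manifold R m) (x0 : M) (U : set M) (f : M -> R) :
  open U -> U x0 -> (forall x, U x -> smooth_atM f x) ->
  exists2 F, smooth_fun F & \forall x \near x0, F x = f x.
Proof.
move=> oU Ux0 sf; have [chi [K [cK KU chi0] [schi chi1]]] := bump oU Ux0.
exists (fun x => chi x * f x); first exact: (smooth_fun_cutoff cK KU).
by apply: filterS chi1 => x ->; rewrite mul1r.
Qed.

Lemma chart_extend m (M : manifold R m) (phi : chart R M m) (x0 : M) :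
  atlas phi -> cdom phi x0 -> exists Fx : 'I_m -> M -> R,
    (forall j, smooth_fun (Fx j)) /\
    \forall x \near x0, forall j, Fx j x = cmap phi x 0 j.
Proof.
move=> aphi xd.
have H j : exists k, smooth_fun k /\ \forall x \near x0, k x = cmap phi x 0 j.
  have [|k sk kE] :=
      @smooth_fun_extend _ _ _ _ (fun x => cmap phi x 0 j) (cdom_open phi) xd.
    by move=> x ?; exact: smooth_at_cmap.
  by exists k.
have [Fx FxP] := fin_all_exists H.
by exists Fx; split=> [j|]; [have [] := FxP j|apply: near_forall => j; have [] := FxP j].
Qed.

End Manifolds.

(** * Tangent vectors *)

Section Tangent.
Variable R : realType.

Lemma derive_smooth_comp n k (f : 'rV[R]_k -> R) (b : 'rV[R]_n -> 'rV[R]_k)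
    (y : 'rV[R]_n) i :
  smooth_at f (b y) -> (forall j, smooth_at (fun z => b z 0 j) y) ->
  'D_(delta_mx 0 i) (f \o b) y =
    \sum_j 'D_(delta_mx 0 i) (fun z => b z 0 j) y * 'D_(delta_mx 0 j) f (b y).
Proof.
move=> sf sb.
have [|j||_ ->//] := @chain_rule R _ _ f b y (delta_mx 0 i).
- by apply: continuous_rV => j; exact: smooth_at_cont (sb j).
- exact: smooth_at_derivable (sb j).
- exact: (sf 1%N).
Qed.

Lemma derive_curve n m (M : manifold R m) (G : 'rV[R]_n -> M) (f : M -> R) y i
    (phi : chart R M m) :
  atlas phi -> cdom phi (G y) -> smooth_atRM G y -> smooth_atM f (G y) ->
  'D_(delta_mx 0 i) (f \o G) y =
    \sum_j 'D_(delta_mx 0 i) (fun z => cmap phi (G z) 0 j) y * partial phi j (G y) f.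
Proof.
move=> aphi Gd [cG sG] sf.
have nd : \forall z \near y, cdom phi (G z) := nbhs_singleton cG _ (near_cdom Gd).
rewrite (@near_eq_derive _ _ _ _ ((f \o cinv phi) \o (cmap phi \o G))); last first.
  by apply: filterS nd => z zd /=; rewrite cmapK.
rewrite derive_smooth_comp //; first exact: smooth_atM_chart.
by move=> j; exact: sG.
Qed.

(** The chain rule for the change from the given chart to [phi]. *)
Lemma tangent_chart m (M : manifold R m) (x : M) (D : (M -> R) -> R) (phi : chart R M m) :
  tangent x D -> atlas phi -> cdom phi x ->
  exists c : 'I_m -> R, forall f, smooth_fun f -> D f = \sum_i c i * partial phi i x f.
Proof.
move=> [[psi [apsi xpsi [c DE]]] _] aphi xphi.
exists (fun i => \sum_j c j *
  'D_(delta_mx 0 j) (fun z => cmap phi (cinv psi z) 0 i) (cmap psi x)) => f sf.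
rewrite DE //; under [RHS]eq_bigr do rewrite mulr_suml.
rewrite exchange_big /=; apply: eq_bigr => j _.
rewrite {1}/partial (@derive_curve _ _ _ _ _ _ _ phi) ?cmapK //.
- by rewrite mulr_sumr; apply: eq_bigr => i _; rewrite mulrA.
- exact: smooth_at_cinv.
- exact: smooth_fun_at.
Qed.

(** By the chain rule the coefficients in a chart are the velocities of its
    coordinates along [G]. *)
Lemma tangent_push n m (M : manifold R m) (G : 'rV[R]_n -> M) y (c : 'I_n -> R) :
  smooth_atRM G y ->
  tangent (G y) (fun f => if `[< smooth_fun f >]
    then \sum_j c j * 'D_(delta_mx 0 j) (f \o G) y else 0).
Proof.
move=> sG; split=> [|f nsf]; last by rewrite asboolF.
have [phi aphi Gd] := atlas_cover (G y).
exists phi; split=> //; exists (fun i => \sum_j c j *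
  'D_(delta_mx 0 j) (fun z => cmap phi (G z) 0 i) y) => f sf.
rewrite asboolT //; under [RHS]eq_bigr do rewrite mulr_suml.
rewrite exchange_big /=; apply: eq_bigr => j _.
rewrite (@derive_curve _ _ _ _ _ _ _ phi) //; last exact: smooth_fun_at.
by rewrite mulr_sumr; apply: eq_bigr => i _; rewrite mulrA.
Qed.

Lemma tangent_tangent_map m n (M : manifold R m) (N : manifold R n) (H : M -> N)
    (x : M) (D : (M -> R) -> R) :
  smooth_map H -> tangent x D -> tangent (H x) (tangent_map H D).
Proof.
move=> sH tD; have [phi aphi xd] := atlas_cover x.
have [c DE] := tangent_chart tD aphi xd.
have sG : smooth_atRM (H \o cinv phi) (cmap phi x).
  apply: smooth_at_RMM; first exact: smooth_at_cinv.
  by rewrite cmapK //; exact: smooth_map_at.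
have := tangent_push c sG; rewrite /= cmapK //; congr tangent.
apply/funext => f; rewrite /tangent_map; case: asboolP => // sf.
by rewrite DE //; exact: smooth_fun_comp.
Qed.

(** If [G] and [a] are inverse to each other near [x], then [D] is determined by
    its values on the components of [a].  These are only local, so they enter
    through global functions [F j] with the same germ at [x].
    [G] is either the inverse of a chart or [local_param]. *)
Lemma tangent_coords n m (M : manifold R m) (x : M) (D : (M -> R) -> R)
    (G : 'rV[R]_n -> M) (a : M -> 'rV[R]_n) (F : 'I_n -> M -> R) (f : M -> R) :
  tangent x D -> smooth_atRM G (a x) -> (\forall y \near x, G (a y) = y) ->
  (forall j, smooth_fun (F j)) -> (forall j, \forall y \near x, F j y = a y 0 j) ->
  smooth_fun f ->
  D f = \sum_j D (F j) * 'D_(delta_mx 0 j) (f \o G) (a x).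
Proof.
move=> tD sG Ga sF Fa sf; have [phi aphi xd] := atlas_cover x.
have [c DE] := tangent_chart tD aphi xd.
have sa j : smooth_atM (fun y => a y 0 j) x.
  by apply: smooth_atM_eq (Fa j) _; exact: smooth_fun_at.
have sfG : smooth_at (f \o G) (a x).
  by apply: smooth_at_RMR => //; exact: smooth_fun_at.
rewrite DE // (eq_bigr (fun j => \sum_i c i * partial phi i x (F j) *
    'D_(delta_mx 0 j) (f \o G) (a x))) => [|j _]; last by rewrite DE // mulr_suml.
rewrite exchange_big /=; apply: eq_bigr => i _.
rewrite {1}/partial (@near_eq_derive _ _ _ _ ((f \o G) \o (a \o cinv phi))); last first.
  by apply: filterS (near_cinv xd Ga) => z [/= -> _ _].
rewrite derive_smooth_comp; first last.
- by move=> j; exact: smooth_atM_chart (sa j).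
- by rewrite /= cmapK.
rewrite mulr_sumr /= cmapK //; apply: eq_bigr => j _.
rewrite mulrA; congr (_ * _ * _); apply: near_eq_derive.
by apply: filterS (near_cinv xd (Fa j)) => z [/= -> _ _].
Qed.

Lemma tangent_leibniz m (M : manifold R m) (x : M) (D : (M -> R) -> R) (f a b : M -> R) :
  tangent x D -> smooth_fun f -> smooth_fun a -> smooth_fun b ->
  D (fun y => f y * a y + b y) = f x * D a + D f * a x + D b.
Proof.
move=> tD sf sa sb; have [phi aphi xd] := atlas_cover x.
have [c DE] := tangent_chart tD aphi xd.
have sat k : smooth_fun k -> smooth_at (k \o cinv phi) (cmap phi x).
  by move=> sk; apply: smooth_atM_chart => //; exact: smooth_fun_at.
have dat (k : M -> R) i (sk : smooth_fun k) :
    derivable (k \o cinv phi) (cmap phi x) (delta_mx 0 i).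
  exact: smooth_at_derivable (sat k sk).
rewrite !DE //; last first.
  apply/smooth_funP => y; apply: smooth_atMD; last exact: smooth_fun_at.
  by apply: smooth_atM_mul; exact: smooth_fun_at.
rewrite mulr_sumr mulr_suml -!big_split /=; apply: eq_bigr => i _.
have -> : partial phi i x (fun y => f y * a y + b y) =
    f x * partial phi i x a + partial phi i x f * a x + partial phi i x b.
  rewrite /partial deriveD; [|by apply: derivableM; exact: dat|exact: dat].
  rewrite (deriveM (dat f i sf) (dat a i sa)) /= cmapK //.
  by rewrite /GRing.scale /= [in RHS](mulrC _ (a x)).
by rewrite !mulrDr mulrCA !mulrA.
Qed.

Lemma smooth_atRM_eq n m (M : manifold R m) (G H : 'rV[R]_n -> M) (y : 'rV[R]_n) :
  (\forall z \near y, G z = H z) -> smooth_atRM G y -> smooth_atRM H y.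
Proof.
move=> GH [cG sG]; split.
  by apply: filterS2 (nbhs_interior GH) cG => z; exact: near_eq_continuous.
move=> psi apsi; rewrite -(nbhs_singleton GH) => Gd j.
by apply: smooth_at_eq (sG psi apsi Gd j); apply: filterS GH => z ->.
Qed.

Lemma smooth_atMM_eq m n (M : manifold R m) (N : manifold R n) (G H : M -> N) (x : M) :
  (\forall y \near x, G y = H y) -> smooth_atMM G x -> smooth_atMM H x.
Proof.
move=> GH [phi [aphi xd] sG]; exists phi => //; apply: smooth_atRM_eq sG.
by apply: filterS (near_cinv xd GH) => z [].
Qed.

End Tangent.

(** * Sections and one-forms of a vector bundle *)

Section Bundles.
Variables (R : realType) (m : nat) (M : manifold R m) (r : nat) (E : vectorBundle M r).
Implicit Types (s : trivialization E) (u v : M -> E) (x : M) (w : E).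

Lemma near_tdom s x : tdom s x -> \forall y \near x, tdom s y.
Proof. by move=> xd; apply: open_nbhs_nbhs; split=> //; exact: tdom_open. Qed.

Lemma open_vproj (U : set M) : open U -> open (@vproj _ _ _ _ E @^-1` U).
Proof.
have /continuousP := smooth_map_continuous (@vproj_smooth _ _ _ _ E); exact.
Qed.

Lemma near_vproj (P : set M) w : (\forall x \near vproj w, P x) ->
  \forall w' \near w, P (vproj w').
Proof.
by move=> H; exact: (@smooth_map_continuous _ _ _ _ _ _ (@vproj_smooth _ _ _ _ E) w _ H).
Qed.

Lemma smooth_at_vproj w : smooth_atMM (@vproj _ _ _ _ E) w.
Proof. exact: (smooth_mapP _).1 (@vproj_smooth _ _ _ _ E) w. Qed.

Lemma smooth_at_tcoord s w a :
  tdom s (vproj w) -> smooth_atM (fun w => tcoord s w 0 a) w.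
Proof.
move=> wd; have := (smooth_fun_onP _ (open_vproj (tdom_open s))).1 (tcoord_smooth s a).
by apply.
Qed.

(** The coordinates (x, y) of the total space given by a chart of the base and a
    local trivialization; they need not belong to the atlas of [E]. *)
Definition local_param s (phi : chart R M m) (y : 'rV[R]_(m + r)) : E :=
  tpoint s (cinv phi (lsubmx y)) (rsubmx y).

Lemma smooth_at_local_param s (phi : chart R M m) x (c : 'rV[R]_r) :
  atlas phi -> cdom phi x -> tdom s x ->
  smooth_atRM (local_param s phi) (row_mx (cmap phi x) c).
Proof.
move=> aphi xd xs.
have oA : open [set y : 'rV[R]_(m + r) | (cmap phi @` (tdom s `&` cdom phi)) (lsubmx y)].
  apply: (@open_comp _ _ lsubmx); last exact: open_cmap_image (tdom_open s).
  by move=> y _; apply: differentiable_continuous; exact: differentiable_lsubmx.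
have := (smooth_from_onP _ oA).1 (tpoint_smooth s aphi); apply.
by rewrite /= row_mxKl; exists x.
Qed.

Lemma smooth_atM_row_mx k l (b : M -> 'rV[R]_k) (c : M -> 'rV[R]_l) x :
  (forall j, smooth_atM (fun y => b y 0 j) x) ->
  (forall j, smooth_atM (fun y => c y 0 j) x) ->
  forall j, smooth_atM (fun y => row_mx (b y) (c y) 0 j) x.
Proof.
move=> sb sc j; rewrite -(splitK j); case: (fintype.split j) => i /=.
  by apply: smooth_atM_eq (sb i); near=> y; rewrite row_mxEl.
by apply: smooth_atM_eq (sc i); near=> y; rewrite row_mxEr.
Unshelve. all: by end_near. Qed.

Lemma smooth_at_tpoint s v (c : M -> 'rV[R]_r) x : tdom s x ->
  (\forall y \near x, v y = tpoint s y (c y)) ->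
  (forall a, smooth_atM (fun y => c y 0 a) x) -> smooth_atMM v x.
Proof.
move=> xs vE sc; have [phi aphi xd] := atlas_cover x.
apply: (@smooth_atMM_eq _ _ _ _ _ (local_param s phi \o
    (fun y => row_mx (cmap phi y) (c y)))).
  apply: filterS2 vE (near_cdom xd) => y -> yd.
  by rewrite /= /local_param row_mxKl row_mxKr cmapK.
apply: smooth_at_MRM; last exact: smooth_at_local_param.
by apply: smooth_atM_row_mx => // j; exact: smooth_at_cmap.
Qed.

Lemma section_smooth s v x a : smooth_section v -> tdom s x ->
  smooth_atM (fun y => tcoord s (v y) 0 a) x.
Proof.
move=> [/smooth_mapP sv vP] xs.
apply: (@smooth_at_MMR _ _ _ _ _ v (fun w => tcoord s w 0 a)) => //.
by apply: smooth_at_tcoord; rewrite vP.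
Qed.

Lemma smooth_sectionP v : (forall x, vproj (v x) = x) ->
  (forall x, exists2 s, tdom s x &
     forall a, smooth_atM (fun y => tcoord s (v y) 0 a) x) ->
  smooth_section v.
Proof.
move=> vP sv; split=> //; apply/smooth_mapP => x.
have [s xs sa] := sv x.
apply: (@smooth_at_tpoint s _ (fun y => tcoord s (v y))) => //.
by apply: filterS (near_tdom xs) => y ys; rewrite -{2}(vP y) tcoordK // vP.
Qed.

Lemma fibre_eq (w w' : E) : vproj w = vproj w' ->
  (forall s, tdom s (vproj w) -> tcoord s w = tcoord s w') -> w = w'.
Proof.
move=> ww' H; have [s ws] := vtriv E (vproj w).
by rewrite -(tcoordK ws) (H s ws) ww' tcoordK // -ww'.
Qed.

Lemma section_eq u v : smooth_section u -> smooth_section v ->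
  (forall x s, tdom s x -> tcoord s (u x) = tcoord s (v x)) -> u = v.
Proof.
move=> [_ uP] [_ vP] H; apply/funext => x; apply: fibre_eq; rewrite uP ?vP // => s.
exact: H.
Qed.

Lemma sadd_coord s u v x : vproj (u x) = x -> vproj (v x) = x -> tdom s x ->
  tcoord s (sadd u v x) = tcoord s (u x) + tcoord s (v x).
Proof. by move=> ux vx xs; rewrite tcoordD ?ux ?vx. Qed.

Lemma sscale_coord s (f : M -> R) u x : vproj (u x) = x -> tdom s x ->
  tcoord s (sscale f u x) = f x *: tcoord s (u x).
Proof. by move=> ux xs; rewrite tcoordZ ?ux. Qed.

Lemma sadd_proj u v x : vproj (u x) = x -> vproj (v x) = x -> vproj (sadd u v x) = x.
Proof. by move=> ux vx; rewrite vproj_add ?ux ?vx. Qed.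

Lemma sscale_proj f u x : vproj (u x) = x -> vproj (sscale f u x) = x.
Proof. by move=> ux; rewrite vproj_scale. Qed.

Lemma sadd_section u v :
  smooth_section u -> smooth_section v -> smooth_section (sadd u v).
Proof.
move=> su sv; have [_ uP] := su; have [_ vP] := sv.
apply: smooth_sectionP => [x|x]; first exact: sadd_proj.
have [s xs] := vtriv E x; exists s => // a.
apply: smooth_atM_eq (smooth_atMD (section_smooth a su xs) (section_smooth a sv xs)).
by apply: filterS (near_tdom xs) => y ys; rewrite sadd_coord // mxE.
Qed.

Lemma sscale_section f u :
  smooth_fun f -> smooth_section u -> smooth_section (sscale f u).
Proof.
move=> /smooth_funP sf su; have [_ uP] := su.
apply: smooth_sectionP => [x|x]; first exact: sscale_proj.
have [s xs] := vtriv E x; exists s => // a.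
apply: smooth_atM_eq (smooth_atM_mul (sf x) (section_smooth a su xs)).
by apply: filterS (near_tdom xs) => y ys; rewrite sscale_coord // mxE.
Qed.

(** Scaling by 0 makes the choice of the trivialization harmless. *)
Definition zero_section x : E := vscale 0 (tpoint (sval (cid (vtriv E x))) x 0).

Lemma zero_section_proj x : vproj (zero_section x) = x.
Proof.
by rewrite /zero_section; case: cid => s /= xs; rewrite vproj_scale tpoint_proj.
Qed.

Lemma zero_section_coord s x : tdom s x -> tcoord s (zero_section x) = 0.
Proof.
move=> xs; rewrite /zero_section; case: cid => s' /= xs'.
by rewrite tcoordZ ?scale0r // tpoint_proj.
Qed.

Lemma zero_section_smooth : smooth_section zero_section.
Proof.
apply: smooth_sectionP => [x|x]; first exact: zero_section_proj.
have [s xs] := vtriv E x; exists s => // a.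
apply: smooth_atM_eq (smooth_atM_cst 0 x).
by apply: filterS (near_tdom xs) => y ys; rewrite zero_section_coord // mxE.
Qed.

(** The constant section [c] of the trivialization, multiplied by a bump function
    and continued by zero. *)
Lemma section_extend s x0 (c : 'rV[R]_r) : tdom s x0 ->
  exists2 v, smooth_section v & \forall x \near x0, v x = tpoint s x c.
Proof.
move=> xs; have [chi [K [cK KU chi0] [schi chi1]]] := bump (tdom_open s) xs.
pose v x := if `[< tdom s x >] then tpoint s x (chi x *: c) else zero_section x.
exists v; last first.
  by apply: filterS2 chi1 (near_tdom xs) => x x1 xs'; rewrite /v asboolT // x1 scale1r.
have vz x : ~ K x -> v x = zero_section x.
  move=> Kx; rewrite /v; case: asboolP => // xs'; rewrite chi0 // scale0r.
  by have := @tcoordK _ _ _ _ _ s (zero_section x);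
    rewrite zero_section_proj zero_section_coord //; apply.
have vP x : vproj (v x) = x.
  by rewrite /v; case: asboolP => xs'; rewrite ?zero_section_proj ?tpoint_proj.
apply: smooth_sectionP => // x; have [Kx|Kx] := pselect (K x).
  have xs' := KU _ Kx; exists s => // a.
  apply: (@smooth_atM_eq _ _ _ (fun y => chi y * c 0 a)).
    by apply: filterS (near_tdom xs') => y ys; rewrite /v asboolT // tpointK // mxE.
  by apply: smooth_atM_mul; [exact: smooth_fun_at|exact: smooth_atM_cst].
have [t xt] := vtriv E x; exists t => // a.
apply: smooth_atM_eq (smooth_atM_cst 0 x).
have nK : nbhs x (~` K) by apply: open_nbhs_nbhs; split=> //; exact: closed_openC.
by apply: filterS2 nK (near_tdom xt) => y /vz -> yt; rewrite zero_section_coord // mxE.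
Qed.

Lemma local_frame s x0 : tdom s x0 -> exists S : 'I_r -> M -> E,
  (forall a, smooth_section (S a)) /\ \forall x \near x0, forall a, S a x = tframe s a x.
Proof.
move=> xs.
have H a : exists v, smooth_section v /\ \forall x \near x0, v x = tframe s a x.
  by have [v sv vE] := section_extend (delta_mx 0 a) xs; exists v.
have [S SP] := fin_all_exists H.
by exists S; split=> [a|]; [have [] := SP a|apply: near_forall => a; have [] := SP a].
Qed.

Lemma section_through w : exists2 v, smooth_section v & v (vproj w) = w.
Proof.
have [s ws] := vtriv E (vproj w).
have [v sv vE] := section_extend (tcoord s w) ws.
by exists v => //; rewrite (nbhs_singleton vE) tcoordK.
Qed.

Definition lincomb (f : 'I_r -> M -> R) (S : 'I_r -> M -> E) (l : seq 'I_r) : M -> E :=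
  foldr (fun a v => sadd (sscale (f a) (S a)) v) zero_section l.

Lemma lincomb_section f S l : (forall a, smooth_fun (f a)) ->
  (forall a, smooth_section (S a)) -> smooth_section (lincomb f S l).
Proof.
move=> sf sS; elim: l => [|a l IH] /=; first exact: zero_section_smooth.
by apply: sadd_section => //; exact: sscale_section.
Qed.

Lemma lincomb_proj f S l x : (forall a, vproj (S a x) = x) -> vproj (lincomb f S l x) = x.
Proof.
move=> SP; elim: l => [|a l IH] /=; first exact: zero_section_proj.
by rewrite sadd_proj // sscale_proj.
Qed.

Lemma lincomb_coord s f S l x : (forall a, vproj (S a x) = x) -> tdom s x ->
  tcoord s (lincomb f S l x) = \sum_(a <- l) f a x *: tcoord s (S a x).
Proof.
move=> SP xs; elim: l => [|a l IH] /=; first by rewrite big_nil zero_section_coord.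
by rewrite big_cons -IH sadd_coord ?sscale_coord ?sscale_proj ?lincomb_proj.
Qed.

Section OneForm.
Variable omega : (M -> E) -> M -> R.
Hypothesis omegaP : one_form omega.

Lemma one_form0 x : omega zero_section x = 0.
Proof.
have E0 : sadd (sscale (cst 1) zero_section) zero_section = zero_section.
  apply/funext => y; have zP := zero_section_proj y.
  apply: fibre_eq; first by rewrite sadd_proj // sscale_proj.
  rewrite sadd_proj ?sscale_proj // => s ys.
  by rewrite sadd_coord ?sscale_coord ?sscale_proj // zero_section_coord // scaler0 addr0.
have sz := zero_section_smooth.
have := omegaP.2 (cst 1) zero_section zero_section x (@smooth_fun_cst R m M 1) sz sz.
by rewrite E0 mul1r => /eqP; rewrite -subr_eq0 opprD addrA subrr sub0r oppr_eq0 => /eqP.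
Qed.

Lemma one_form_scale f v x : smooth_fun f -> smooth_section v ->
  omega (sscale f v) x = f x * omega v x.
Proof.
move=> sf sv; have vP := sv.2.
have E0 : sadd (sscale f v) zero_section = sscale f v.
  apply/funext => y; have zP := zero_section_proj y.
  apply: fibre_eq; first by rewrite sadd_proj ?sscale_proj.
  rewrite sadd_proj ?sscale_proj // => s ys.
  by rewrite sadd_coord ?sscale_proj // zero_section_coord // addr0.
by rewrite -E0 omegaP.2 // ?one_form0 ?addr0 //; exact: zero_section_smooth.
Qed.

Lemma one_form_lincomb f S l x : (forall a, smooth_fun (f a)) ->
  (forall a, smooth_section (S a)) ->
  omega (lincomb f S l) x = \sum_(a <- l) f a x * omega (S a) x.
Proof.
move=> sf sS; elim: l => [|a l IH] /=; first by rewrite big_nil one_form0.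
by rewrite big_cons -IH omegaP.2 //; exact: lincomb_section.
Qed.

(** A one-form is local.  With a bump function chi supported where [S] is the
    frame of [s], the sections chi v and (chi v^a) S_a coincide everywhere, so
    F(M)-linearity computes omega v at the points where chi is 1. *)
Lemma one_form_frame s S v x : tdom s x -> (forall a, smooth_section (S a)) ->
  (\forall y \near x, forall a, S a y = tframe s a y) -> smooth_section v ->
  omega v x = \sum_a omega (S a) x * tcoord s (v x) 0 a.
Proof.
move=> xs sS; rewrite /prop_near1 nbhsE => -[U [oU Ux] US] sv.
have vP := sv.2.
have oV : open (U `&` tdom s) by apply: openI => //; exact: tdom_open.
have [chi [K [cK KU chi0] [schi chi1]]] := bump oV (conj Ux xs).
pose f a y := chi y * tcoord s (v y) 0 a.
have sf a : smooth_fun (f a).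
  by apply: (smooth_fun_cutoff cK KU chi0 schi) => y [_ ys]; exact: section_smooth.
have SP a y : vproj (S a y) = y by have [_] := sS a.
have E0 : sscale chi v = lincomb f S (index_enum 'I_r).
  apply/funext => y; apply: fibre_eq; first by rewrite sscale_proj // lincomb_proj.
  rewrite sscale_proj // => t yt; rewrite sscale_coord // lincomb_coord //.
  have [/KU[Uy ys]|/chi0 y0] := pselect (K y); last first.
    by rewrite y0 scale0r big1 // => a _; rewrite /f y0 mul0r scale0r.
  suff : sscale chi v y = lincomb f S (index_enum 'I_r) y.
    by move/(congr1 (tcoord t)); rewrite sscale_coord // lincomb_coord.
  have Ep : vproj (sscale chi v y) = y by rewrite sscale_proj.
  have El : vproj (lincomb f S (index_enum 'I_r) y) = y by rewrite lincomb_proj.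
  rewrite -(@tcoordK _ _ _ _ _ s (sscale _ _ _)) ?Ep //.
  rewrite -(@tcoordK _ _ _ _ _ s (lincomb _ _ _ _)) ?El //; congr (tpoint s y _).
  rewrite sscale_coord // lincomb_coord // [LHS]row_sum_delta.
  apply: eq_bigr => a _; rewrite US // tpointK //; congr (_ *: _).
  by rewrite mxE.
have := one_form_scale x schi sv; rewrite E0 (nbhs_singleton chi1) mul1r => <-.
rewrite one_form_lincomb //; apply: eq_bigr => a _.
by rewrite /f (nbhs_singleton chi1) mul1r mulrC.
Qed.

Lemma one_form_pointwise v v' x : smooth_section v -> smooth_section v' ->
  v x = v' x -> omega v x = omega v' x.
Proof.
move=> sv sv' vv'; have [s xs] := vtriv E x; have [S [sS SE]] := local_frame xs.
by rewrite (one_form_frame xs sS SE sv) (one_form_frame xs sS SE sv') vv'.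
Qed.

(** The value of the hat at [w] is omega v at the base point, for any section [v]
    through [w]; by the choice-free formula [one_form_frame] it is given by
    smooth components in every trivialization. *)
Lemma hat_spec :
  is_hat omega (hat omega) /\ forall v x, smooth_section v -> hat omega (v x) = omega v x.
Proof.
have H w : exists v, smooth_section v /\ v (vproj w) = w.
  by have [v sv vw] := section_through w; exists v.
have [V VP] := choice H.
pose f w := omega (V w) (vproj w).
have fE v x : smooth_section v -> f (v x) = omega v x.
  move=> sv; have [sV VE] := VP (v x); have [_ vP] := sv.
  by rewrite /f -[in RHS](vP x); apply: one_form_pointwise; rewrite // VE vP.
have fS s S x a : tdom s x -> (forall a, smooth_section (S a)) ->
    (\forall y \near x, forall a, S a y = tframe s a y) ->
    f (tframe s a x) = omega (S a) x.
  by move=> xs sS /nbhs_singleton SE; rewrite -SE fE.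
have fhat : is_hat omega f.
  move=> s; exists (fun a x => f (tframe s a x)).
  have loc v x : smooth_section v -> tdom s x ->
      omega v x = \sum_a f (tframe s a x) * tcoord s (v x) 0 a.
    move=> sv xs; have [S [sS SE]] := local_frame xs.
    rewrite (one_form_frame xs sS SE) //; apply: eq_bigr => a _.
    by rewrite (fS _ _ _ _ xs sS SE).
  split=> // [a|w ws].
    apply/(smooth_fun_onP _ (tdom_open s)) => x xs.
    have [S [sS SE]] := local_frame xs.
    apply: (@smooth_atM_eq _ _ _ (omega (S a))).
      apply: filterS2 (nbhs_interior SE) (near_tdom xs) => y yE ys.
      by rewrite (fS _ _ _ _ ys sS yE).
    by apply: smooth_fun_at; exact: omegaP.1.
  have [sV VE] := VP w; rewrite -{1}VE fE // loc //.
  by apply: eq_bigr => a _; rewrite mulrC VE.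
have hathat : is_hat omega (hat omega).
  by rewrite /hat; apply: xgetPex; exists f.
split=> // v x sv; have vP := sv.2.
have [s xs] := vtriv E x; have [c [_ oE hE]] := hathat s.
rewrite hE ?vP // (oE v) //; by apply: eq_bigr => a _; rewrite mulrC.
Qed.

Lemma hat_frame s S w : tdom s (vproj w) -> (forall a, smooth_section (S a)) ->
  (\forall y \near vproj w, forall a, S a y = tframe s a y) ->
  hat omega w = \sum_a tcoord s w 0 a * omega (S a) (vproj w).
Proof.
move=> ws sS SE; have [v sv vw] := section_through w.
rewrite -{1}vw hat_spec.2 // (one_form_frame ws sS SE) // vw.
by apply: eq_bigr => a _; rewrite mulrC.
Qed.

Lemma hat_smooth : smooth_fun (hat omega).
Proof.
apply/smooth_funP => w; have [s ws] := vtriv E (vproj w).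
have [S [sS SE]] := local_frame ws.
apply: (@smooth_atM_eq _ _ _ (fun w => \sum_a tcoord s w 0 a * omega (S a) (vproj w))).
  have := near_vproj (nbhs_interior SE).
  apply: filterS2 (near_vproj (near_tdom ws)) => w' ws' w'E.
  by rewrite (hat_frame ws' sS w'E).
apply: smooth_atM_sum => a; apply: smooth_atM_mul; first exact: smooth_at_tcoord.
apply: (@smooth_at_MMR _ _ _ _ _ (@vproj _ _ _ _ E)); first exact: smooth_at_vproj.
by apply: smooth_fun_at; exact: omegaP.1.
Qed.

End OneForm.

End Bundles.

(** * The derivation of the sections defined by the bracket *)

Section LieDerivative.
Variables (R : realType) (m p r : nat) (M N : manifold R m).
Variables (h : diffeomorphism M N) (eta : diffeomorphism N M).
Variables (F : vectorBundle N p) (A : genLieAlgebroid h eta F).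
Variables (E : vectorBundle M r) (g : E -> F) (g_morphism : bundle_morphism h g).
Variables (g' : F -> E) (g_inverse : local_inverse h g g').
Implicit Types (v w : M -> E) (z : N -> F).

Lemma push_section v : smooth_section v -> smooth_section (push h g v).
Proof.
have [sg gP _ _] := g_morphism; move=> [sv vP]; split; last first.
  by move=> q; rewrite /push /= gP vP dinvK.
apply: smooth_map_comp; last exact: smooth_map_comp sg.
exact: dinv_smooth.
Qed.

Lemma push_linear (f : M -> R) v w : smooth_section v -> smooth_section w ->
  push h g (sadd (sscale f v) w) =
  sadd (sscale (f \o dinv h) (push h g v)) (push h g w).
Proof.
have [_ _ gD gZ] := g_morphism; move=> [_ vP] [_ wP]; apply/funext => q.
by rewrite /push /sadd /sscale /= gD ?gZ // vproj_scale vP wP.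
Qed.

(** [g] is linear on the fibres, hence given by its components on the frames. *)
Lemma g_coord (s : trivialization E) (t : trivialization F) x c :
  tdom s x -> tdom t (h x) -> tcoord t (g (tpoint s x c)) = c *m components h g s t x.
Proof.
have [_ gP gD gZ] := g_morphism => xs xt.
have tP d : vproj (tpoint s x d) = x by exact: tpoint_proj.
have gtP d : vproj (g (tpoint s x d)) = h x by rewrite gP tP.
have tD d d' : tpoint s x (d + d') = vadd (tpoint s x d) (tpoint s x d').
  have P : vproj (vadd (tpoint s x d) (tpoint s x d')) = x by rewrite vproj_add tP.
  by rewrite -(@tcoordK _ _ _ _ _ s (vadd _ _)) P // tcoordD ?tP // !tpointK.
have tZ a d : tpoint s x (a *: d) = vscale a (tpoint s x d).
  have P : vproj (vscale a (tpoint s x d)) = x by rewrite vproj_scale tP.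
  by rewrite -(@tcoordK _ _ _ _ _ s (vscale _ _)) P // tcoordZ ?tP // tpointK.
pose q d := tcoord t (g (tpoint s x d)).
have qD d d' : q (d + d') = q d + q d' by rewrite /q tD gD ?tP // tcoordD ?gtP.
have qZ a d : q (a *: d) = a *: q d by rewrite /q tZ gZ tcoordZ // gtP.
rewrite -/(q c) {1}(row_sum_delta c).
have -> : c *m components h g s t x = \sum_j c 0 j *: q (delta_mx 0 j).
  rewrite {1}(row_sum_delta c) mulmx_suml; apply: eq_bigr => j _.
  by rewrite -scalemxAl -rowE; congr (_ *: _); apply/rowP => al; rewrite !mxE.
elim: (index_enum _) => [|j l IH]; last by rewrite !big_cons qD qZ IH.
by rewrite !big_nil -(scale0r 0) qZ scale0r.
Qed.

Lemma inverse_coord (s : trivialization E) (t : trivialization F) :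
  exists c : M -> 'M[R]_(p, r), forall x, tdom s x -> tdom t (h x) ->
    [/\ forall al b, smooth_atM (fun y => c y al b) x,
        forall e, vproj e = h x -> vproj (g' e) = x,
        forall e, vproj e = h x -> tcoord s (g' e) = tcoord t e *m c x &
        forall e, vproj e = x -> g' (g e) = e].
Proof.
have [_ gP gD gZ] := g_morphism.
have [gt [sgt gtP]] := g_inverse s t; exists gt => x xs xt.
have oA : open (tdom s `&` h @^-1` tdom t).
  apply: openI; first exact: tdom_open.
  have /continuousP := smooth_map_continuous (@dfun_smooth _ _ _ _ _ h); apply.
  exact: tdom_open.
have [gg _ gE] := gtP x xs xt.
have g'E e : vproj e = h x -> g' e = tpoint s x (tcoord t e *m gt x).
  by move=> ex; rewrite -gE -ex tcoordK // ex.
split.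
- by move=> al b; have := (smooth_fun_onP _ oA).1 (sgt al b); apply.
- by move=> e /g'E ->; rewrite tpoint_proj.
- by move=> e /g'E ->; rewrite tpointK.
- move=> e ex; rewrite g'E; last by rewrite gP ex.
  rewrite -{1}(tcoordK (t := s) (w := e)) ?ex // g_coord // -mulmxA gg mulmx1.
  by rewrite -ex tcoordK // ex.
Qed.

Lemma inverse_coord_at x : exists (s : trivialization E) (t : trivialization F)
    (c : M -> 'M[R]_(p, r)), 
  [/\ tdom s x, tdom t (h x), forall al b, smooth_atM (fun y => c y al b) x &
    \forall y \near x, [/\ tdom s y, tdom t (h y) & 
      forall e, vproj e = h y -> tcoord s (g' e) = tcoord t e *m c y]].
Proof.
have [s xs] := vtriv E x; have [t xt] := vtriv F (h x).
have [c cP] := inverse_coord s t; exists s, t, c; split=> //.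
  by have [] := cP x xs xt.
have nt : \forall y \near x, tdom t (h y).
  have sh := @dfun_smooth _ _ _ _ _ h.
  exact: (@smooth_map_continuous _ _ _ _ _ _ sh x _ (near_tdom xt)).
by apply: filterS2 (near_tdom xs) nt => y ys yt; split=> //; have [] := cP y ys yt.
Qed.

Lemma inverse_proj e x : vproj e = h x -> vproj (g' e) = x.
Proof.
move=> ex; have [s xs] := vtriv E x; have [t xt] := vtriv F (h x).
have [c cP] := inverse_coord s t; have [_ + _ _] := cP x xs xt; exact.
Qed.

Lemma pull_section z : smooth_section z -> smooth_section (pull h g' z).
Proof.
move=> sz; have [_ zP] := sz; apply: smooth_sectionP => x.
  by rewrite /pull /= (@inverse_proj _ x).
have [s [t [c [xs xt sc cE]]]] := inverse_coord_at x; exists s => // b.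
apply: (@smooth_atM_eq _ _ _ (fun y => \sum_al tcoord t (z (h y)) 0 al * c y al b)).
  by apply: filterS cE => y [_ _ cE]; rewrite /pull /= cE // mxE.
apply: smooth_atM_sum => al; apply: smooth_atM_mul => //.
apply: (@smooth_at_MMR _ _ _ _ _ h (fun q => tcoord t (z q) 0 al)).
  exact: smooth_map_at (@dfun_smooth _ _ _ _ _ h).
exact: section_smooth.
Qed.

Lemma pull_push v : smooth_section v -> pull h g' (push h g v) = v.
Proof.
move=> [_ vP]; apply/funext => x; rewrite /pull /push /= dfunK.
have [s xs] := vtriv E x; have [t xt] := vtriv F (h x).
have [c cP] := inverse_coord s t; have [_ _ _ +] := cP x xs xt; exact.
Qed.

Lemma pull_add z z' : smooth_section z -> smooth_section z' ->
  pull h g' (sadd z z') = sadd (pull h g' z) (pull h g' z').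
Proof.
move=> [_ zP] [_ zP']; apply/funext => x.
have P : vproj (pull h g' (sadd z z') x) = x.
  by rewrite /pull /= (@inverse_proj _ x) // sadd_proj.
have Pz : vproj (pull h g' z x) = x by rewrite /pull /= (@inverse_proj _ x).
have Pz' : vproj (pull h g' z' x) = x by rewrite /pull /= (@inverse_proj _ x).
have [s [t [c [xs xt _ /nbhs_singleton[_ _ cE]]]]] := inverse_coord_at x.
have Q := sadd_proj Pz Pz'.
rewrite -(@tcoordK _ _ _ _ _ s (pull _ _ (sadd _ _) _)) P //.
rewrite -(@tcoordK _ _ _ _ _ s (sadd _ _ _)) Q //; congr (tpoint s x _).
rewrite sadd_coord // /pull /= !cE ?zP ?zP' ?sadd_proj // sadd_coord //.
by rewrite mulmxDl.
Qed.

Lemma pull_scale (f : N -> R) z : smooth_section z ->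
  pull h g' (sscale f z) = sscale (f \o h) (pull h g' z).
Proof.
move=> [_ zP]; apply/funext => x.
have P : vproj (pull h g' (sscale f z) x) = x.
  by rewrite /pull /= (@inverse_proj _ x) // sscale_proj.
have Pz : vproj (pull h g' z x) = x by rewrite /pull /= (@inverse_proj _ x).
have [s [t [c [xs xt _ /nbhs_singleton[_ _ cE]]]]] := inverse_coord_at x.
have Q := sscale_proj (f \o h) Pz.
rewrite -(@tcoordK _ _ _ _ _ s (pull _ _ (sscale _ _) _)) P //.
rewrite -(@tcoordK _ _ _ _ _ s (sscale _ _ _)) Q //; congr (tpoint s x _).
rewrite sscale_coord // /pull /= !cE ?zP ?sscale_proj // sscale_coord //.
by rewrite scalemxAl.
Qed.

(** The structure is linear in the first argument and Leibniz in the second;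
    antisymmetry carries additivity from one to the other. *)
Lemma bracket_derivation z z1 z2 (f : N -> R) : smooth_section z ->
  smooth_section z1 -> smooth_section z2 -> smooth_fun f ->
  bracket A z (sadd (sscale f z1) z2) =
  sadd (sadd (sscale f (bracket A z z1)) (sscale (fun q => anchor A z q f) z1))
       (bracket A z z2).
Proof.
move=> sz s1 s2 sf; have sf1 := sscale_section sf s1.
have E1 : sadd (sscale f z1) z2 = sadd (sscale (cst 1) (sscale f z1)) z2.
  have sf2 := sscale_section (@smooth_fun_cst R _ N 1) sf1.
  apply: section_eq; [exact: sadd_section|exact: sadd_section|] => x s xs.
  by rewrite !sadd_coord ?sf1.2 ?sf2.2 ?s2.2 // [in RHS]sscale_coord ?sf1.2 // scale1r.
have sb a b := @bracket_section _ _ _ _ _ _ _ _ A a b.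
have s12 : smooth_section (sadd (sscale (cst 1) (sscale f z1)) z2).
  by rewrite -E1; exact: sadd_section.
rewrite E1 (bracket_antisym A s12 sz) bracket_linear //.
rewrite (bracket_antisym A sz sf1) (bracket_antisym A sz s2).
rewrite bracket_leibniz //.
have sX : smooth_fun (fun q => anchor A z q f) by apply: (anchor_vf A sz).2.
set b1 := bracket A z z1; set b2 := bracket A z z2.
have sb1 : smooth_section b1 by exact: sb.
have sb2 : smooth_section b2 by exact: sb.
have k c := @smooth_fun_cst R _ N c.
have t1 := sscale_section sf sb1.
have t2 := sscale_section sX s1.
have t3 := sadd_section t1 t2.
have t4 := sscale_section (k (-1)) t3.
have t5 := sscale_section (k (-1)) sb2.
have t6 := sscale_section (k 1) t4.
have t7 := sadd_section t6 t5.
apply: section_eq; [exact: sscale_section|exact: sadd_section|] => x s xs.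
rewrite sscale_coord ?t7.2 // sadd_coord ?t6.2 ?t5.2 // sscale_coord ?t4.2 //.
rewrite sscale_coord ?t3.2 // (@sscale_coord _ _ _ _ _ _ (cst (-1)) b2) ?sb2.2 //.
rewrite (@sadd_coord _ _ _ _ _ _ _ b2) ?t3.2 ?sb2.2 //= !scaleN1r scale1r -opprD opprK.
by [].
Qed.

Variable u : M -> E.
Hypothesis u_section : smooth_section u.

Definition base_field (f : M -> R) (x : M) : R :=
  anchor A (push h g u) (h x) (f \o dinv h).

Definition lie_section v : M -> E := pull h g' (bracket A (push h g u) (push h g v)).

Lemma base_field_smooth f : smooth_fun f -> smooth_fun (base_field f).
Proof.
move=> sf.
apply: (@smooth_fun_comp _ _ _ _ _ h (fun q => anchor A (push h g u) q (f \o dinv h))).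
  exact: dfun_smooth.
apply: (anchor_vf A (push_section u_section)).2.
by apply: smooth_fun_comp => //; exact: dinv_smooth.
Qed.

Lemma base_field_tangent x :
  tangent x (tangent_map (dinv h) (anchor A (push h g u) (h x))).
Proof.
rewrite -{1}(dfunK h x); apply: tangent_tangent_map; first exact: dinv_smooth.
exact: (anchor_vf A (push_section u_section)).1.
Qed.

Lemma base_fieldE f x : smooth_fun f ->
  base_field f x = tangent_map (dinv h) (anchor A (push h g u) (h x)) f.
Proof. by move=> sf; rewrite /tangent_map asboolT. Qed.

Lemma lie_section_smooth v : smooth_section v -> smooth_section (lie_section v).
Proof.
by move=> sv; apply: pull_section; apply: bracket_section; exact: push_section.
Qed.

Lemma lie_section_derivation (f : M -> R) v w : smooth_fun f ->
  smooth_section v -> smooth_section w ->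
  lie_section (sadd (sscale f v) w) =
  sadd (sadd (sscale f (lie_section v)) (sscale (base_field f) v)) (lie_section w).
Proof.
move=> sf sv sw; rewrite /lie_section push_linear //.
have su := push_section u_section.
have spv := push_section sv; have spw := push_section sw.
have sfh : smooth_fun (f \o dinv h).
  by apply: smooth_fun_comp => //; exact: dinv_smooth.
have sX := (anchor_vf A su).2 _ sfh.
have s1 := bracket_section A su spv; have s2 := bracket_section A su spw.
have t1 := sscale_section sfh s1; have t2 := sscale_section sX spv.
rewrite bracket_derivation // pull_add //; last exact: sadd_section.
rewrite pull_add // !pull_scale // pull_push //; congr (sadd (sadd (sscale _ _) _) _).
by apply/funext => x /=; rewrite dfunK.
Qed.

Lemma lie_derivative_one_form omega : one_form omega ->
  one_form (lie_derivative A g g' u omega).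
Proof.
move=> oP; have [so ol] := oP; split=> [v sv|f v w x sf sv sw].
  apply/smooth_funP => x.
  apply: (@smooth_atM_eq _ _ _ (fun x => base_field (omega v) x +
      (-1) * omega (lie_section v) x)).
    by near=> y; rewrite mulN1r.
  apply: smooth_atMD; first by apply: smooth_fun_at; exact: base_field_smooth (so _ sv).
  apply: smooth_atM_mul; first exact: smooth_atM_cst.
  by apply: smooth_fun_at; apply: so; exact: lie_section_smooth.
rewrite /lie_derivative -!/(lie_section _) lie_section_derivation //.
have slv := lie_section_smooth sv; have slw := lie_section_smooth sw.
have sXf := base_field_smooth sf.
have sXv := sscale_section sXf sv.
have -> : (omega (sadd (sscale f v) w) \o dinv h) =
    (fun y => f y * omega v y + omega w y) \o dinv h.
  by apply/funext => q /=; rewrite ol.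
have E1 :
  sadd (sadd (sscale f (lie_section v)) (sscale (base_field f) v)) (lie_section w) =
  sadd (sscale f (lie_section v)) (sadd (sscale (base_field f) v) (lie_section w)).
  have t1 := sscale_section sf slv; have t2 := sadd_section t1 sXv.
  have t3 := sadd_section sXv slw.
  apply: section_eq; [exact: sadd_section|exact: sadd_section|] => y s ys.
  by rewrite !sadd_coord ?t1.2 ?t2.2 ?t3.2 ?sXv.2 ?slw.2 // addrA.
rewrite E1 ol //; last exact: sadd_section.
have ov := so _ sv; have ow := so _ sw.
have ovw : smooth_fun (fun y => f y * omega v y + omega w y).
  apply/smooth_funP => y; apply: smooth_atMD; last exact: smooth_fun_at.
  by apply: smooth_atM_mul; exact: smooth_fun_at.
rewrite ol // -!/(base_field _ _) !base_fieldE //.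
rewrite (tangent_leibniz (base_field_tangent x)) //.
ring.
Unshelve. all: by end_near. Qed.

End LieDerivative.

(** * Tangent vectors of the total space *)

Section BundleCoordinates.
Variables (R : realType) (m : nat) (M : manifold R m) (r : nat) (E : vectorBundle M r).

(** The form is the cut-off a-th element of the dual frame of [s]. *)
Lemma coordinate_form (s : trivialization E) x a : tdom s x ->
  exists tau, one_form tau /\ forall w : E, vproj w = x ->
    \forall w' \near w, hat tau w' = tcoord s w' 0 a.
Proof.
move=> xs; have [chi [K [cK KU chi0] [schi chi1]]] := bump (tdom_open s) xs.
pose tau (v : M -> E) y := chi y * tcoord s (v y) 0 a.
have tauP : one_form tau.
  split=> [v sv|f v v' y sf sv sv'].
    by apply: (smooth_fun_cutoff cK KU chi0 schi) => y ys; exact: section_smooth.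
  rewrite /tau; have [/KU ys|/chi0 ->] := pselect (K y); last first.
    by rewrite !mul0r mulr0 addr0.
  have t1 := sscale_section sf sv.
  rewrite sadd_coord ?sscale_proj ?sv.2 ?sv'.2 // mxE sscale_coord ?sv.2 // mxE.
  ring.
exists tau; split=> // w wx.
have [S [sS SE]] := local_frame xs.
rewrite -wx in xs SE chi1.
have n1 := near_vproj (near_tdom xs).
have n2 := near_vproj (nbhs_interior SE).
apply: filterS3 (near_vproj chi1) n1 n2 => w' w'1 w's w'E.
rewrite (hat_frame tauP w's sS w'E) (bigD1 a) //= big1 ?addr0 => [|b ba].
  by rewrite /tau w'1 (nbhs_singleton w'E) tpointK // mxE !eqxx mul1r mulr1.
rewrite /tau w'1 (nbhs_singleton w'E) tpointK // mxE eqxx /= eq_sym.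
by rewrite (negbTE ba) mulr0 mulr0.
Qed.

Lemma local_param_coords (s : trivialization E) (phi : chart R M m) (w : E) :
  cdom phi (vproj w) -> tdom s (vproj w) -> \forall w' \near w,
  local_param s phi (row_mx (cmap phi (vproj w')) (tcoord s w')) = w'.
Proof.
move=> wd ws; apply: filterS2 (near_vproj (near_cdom wd)) (near_vproj (near_tdom ws)).
by move=> w' w'd w's; rewrite /local_param row_mxKl row_mxKr cmapK // tcoordK.
Qed.

(** The coordinates x^i come from functions of M and the fibre coordinates y^a
    are hats of one-forms, up to the choice of the germ. *)
Lemma tangent_bundle_eq (w : E) (D D' : (E -> R) -> R) : tangent w D -> tangent w D' ->
  (forall k : M -> R, smooth_fun k ->
     D (k \o vproj (b := E)) = D' (k \o vproj (b := E))) ->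
  (forall omega, one_form omega -> D (hat omega) = D' (hat omega)) ->
  D = D'.
Proof.
move=> tD tD' Dbase Dhat; apply/funext => f.
have [sf|nsf] := pselect (smooth_fun f); last by rewrite tD.2 ?tD'.2.
have [phi aphi wd] := atlas_cover (vproj w); have [s ws] := vtriv E (vproj w).
have [Fx [sF FE]] := chart_extend aphi wd.
have [tau tauP] := fin_all_exists (fun a => coordinate_form a ws).
pose T (k : 'I_(m + r)) : E -> R := match fintype.split k with
  | inl j => Fx j \o vproj (b := E) | inr b => hat (tau b) end.
have sT k : smooth_fun (T k).
  rewrite /T; case: (fintype.split k) => [j|b].
    by apply: smooth_fun_comp (sF j); exact: (@vproj_smooth _ _ _ _ E).
  exact: hat_smooth (tauP b).1.
have TE k : \forall w' \near w, T k w' = row_mx (cmap phi (vproj w')) (tcoord s w') 0 k.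
  rewrite /T; case: splitP => [j kj|b kb].
    have -> : k = lshift r j by exact: val_inj.
    by apply: filterS (near_vproj FE) => w' /= ->; rewrite row_mxEl.
  have -> : k = rshift m b by exact: val_inj.
  by apply: filterS ((tauP b).2 w erefl) => w' ->; rewrite row_mxEr.
have sG := smooth_at_local_param (tcoord s w) aphi wd ws.
have Ga := local_param_coords wd ws.
rewrite (tangent_coords tD sG Ga sT TE sf) (tangent_coords tD' sG Ga sT TE sf).
apply: eq_bigr => k _; congr (_ * _); rewrite /T.
case: (fintype.split k) => [j|b]; first exact: Dbase (sF j).
exact: Dhat (tauP b).1.
Qed.

End BundleCoordinates.

(** * The complete lift *)

Section CompleteLift.
Variables (R : realType) (m p r : nat) (M N : manifold R m).
Variables (h : diffeomorphism M N) (eta : diffeomorphism N M).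
Variables (F : vectorBundle N p) (A : genLieAlgebroid h eta F).
Variables (E : vectorBundle M r) (g : E -> F) (g_morphism : bundle_morphism h g).
Variables (g' : F -> E) (g_inverse : local_inverse h g g').
Variable u : M -> E.
Hypothesis u_section : smooth_section u.

Local Notation X := (base_field A g u).
Local Notation L := (lie_section A g g' u).

Definition is_lift (w : E) (D : (E -> R) -> R) : Prop :=
  [/\ tangent w D,
      tangent_map (h \o vproj (b := E)) D = anchor A (push h g u) (h (vproj w)) &
      forall omega, one_form omega ->
        D (hat omega) = hat (lie_derivative A g g' u omega) w].

(** Functions of M and functions of N correspond under [h], so the first condition
    fixes the values on all pullbacks from M. *)
Lemma is_lift_unique w D D' : is_lift w D -> is_lift w D' -> D = D'.
Proof.
move=> [tD bD hD] [tD' bD' hD']; apply: (tangent_bundle_eq tD tD'); last first.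
  by move=> omega oP; rewrite hD // hD'.
move=> k sk.
have skh : smooth_fun (k \o dinv h) by apply: smooth_fun_comp => //; exact: dinv_smooth.
have E0 : (k \o dinv h) \o (h \o vproj (b := E)) = k \o vproj (b := E).
  by apply/funext => w' /=; rewrite dfunK.
have := congr1 (fun D => D (k \o dinv h)) bD; rewrite -bD' /tangent_map asboolT //.
by rewrite E0.
Qed.

Section LocalCoordinates.
Variables (phi : chart R M m) (s : trivialization E).
Variables (S : 'I_r -> M -> E) (Fx : 'I_m -> M -> R).
Hypothesis phi_atlas : atlas phi.
Hypothesis S_smooth : forall a, smooth_section (S a).
Hypothesis Fx_smooth : forall j, smooth_fun (Fx j).

(** Where this holds, the global data [S] and [Fx] stand for the local frame and
    the local coordinates.  Agreement near [x], and not only at [x], is what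
    allows derivatives at [x] to be compared. *)
Definition adapted (x : M) : Prop :=
  [/\ cdom phi x, tdom s x,
      \forall y \near x, forall a, S a y = tframe s a y &
      \forall y \near x, forall j, Fx j y = cmap phi y 0 j].

Definition coords (w : E) : 'rV[R]_(m + r) := row_mx (cmap phi (vproj w)) (tcoord s w).

(** The components X^i and - y^b Gamma_b^a of the lift. *)
Definition lift_coef (w : E) : 'rV[R]_(m + r) :=
  row_mx (\row_j X (Fx j) (vproj w))
         (\row_a - \sum_b tcoord s w 0 b * tcoord s (L (S b) (vproj w)) 0 a).

Definition local_lift (w : E) (f : E -> R) : R :=
  if `[< smooth_fun f >] then
    \sum_k lift_coef w 0 k * 'D_(delta_mx 0 k) (f \o local_param s phi) (coords w)
  else 0.

Lemma near_cinv_coords (P : set M) w : adapted (vproj w) ->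
  (\forall y \near vproj w, P y) ->
  \forall z \near coords w, P (cinv phi (lsubmx z)).
Proof.
move=> [wd _ _ _] nP; apply: (@near_lsubmx _ _ _ (fun z => P (cinv phi z))).
by rewrite /coords row_mxKl; apply: filterS (near_cinv wd nP) => z [].
Qed.

Lemma local_lift_tangent w : adapted (vproj w) -> tangent w (local_lift w).
Proof.
move=> [wd ws _ _].
have := tangent_push (lift_coef w 0)
  (smooth_at_local_param (tcoord s w) phi_atlas wd ws).
by rewrite (nbhs_singleton (local_param_coords wd ws)).
Qed.

Lemma base_field_chart x f : adapted x -> smooth_fun f ->
  X f x = \sum_j X (Fx j) x * partial phi j x f.
Proof.
move=> [xd _ _ xF] sf; rewrite base_fieldE //.
rewrite (@tangent_coords _ _ _ _ _ _ (cinv phi) (cmap phi) Fx f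
  (base_field_tangent A g_morphism u_section x)) //.
- by apply: eq_bigr => j _; rewrite base_fieldE.
- exact: smooth_at_cinv.
- by apply: filterS (near_cdom xd) => y; exact: cmapK.
- by move=> j; apply: filterS xF => y ->.
Qed.

(** In these coordinates the projection is [lsubmx]. *)
Lemma derive_vproj w f k : adapted (vproj w) -> smooth_fun f ->
  'D_(delta_mx 0 k) ((f \o vproj (b := E)) \o local_param s phi) (coords w) =
  if fintype.split k is inl j then partial phi j (vproj w) f else 0.
Proof.
move=> wa sf; have [wd ws _ _] := wa.
rewrite (@near_eq_derive _ _ _ _ ((f \o cinv phi) \o lsubmx)); last first.
  apply: filterS (near_cinv_coords wa (near_tdom ws)) => z zs /=.
  by rewrite /local_param tpoint_proj.
rewrite derive_lsubmx /coords row_mxKl; case: splitP => [j kj|b kb].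
  have -> : k = lshift r j by exact: val_inj.
  by rewrite lsubmx_delta_l.
have -> : k = rshift m b by exact: val_inj.
by rewrite lsubmx_delta_r derive0.
Qed.

Lemma local_lift_base w f : adapted (vproj w) -> smooth_fun f ->
  local_lift w (f \o vproj (b := E)) = X f (vproj w).
Proof.
move=> wa sf; rewrite /local_lift asboolT; last first.
  by apply: smooth_fun_comp => //; exact: (@vproj_smooth _ _ _ _ E).
under eq_bigr do rewrite derive_vproj //.
rewrite big_split_ord /= [X in _ + X]big1 ?addr0 => [|b _]; last first.
  by rewrite (unsplitK (inr b)) mulr0.
rewrite base_field_chart //; apply: eq_bigr => j _.
by rewrite (unsplitK (inl j)) /lift_coef row_mxEl mxE.
Qed.

(** In these coordinates the hat is y^b omega_b with omega_b = omega (S b), a sum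
    of products of a function of y and a function of x. *)
Lemma derive_hat w omega k : adapted (vproj w) -> one_form omega ->
  'D_(delta_mx 0 k) (hat omega \o local_param s phi) (coords w) =
  match fintype.split k with
  | inl j => \sum_b tcoord s w 0 b * partial phi j (vproj w) (omega (S b))
  | inr a => omega (S a) (vproj w)
  end.
Proof.
move=> wa oP; have [wd ws wS _] := wa.
pose q b (z : 'rV[R]_(m + r)) : R := z 0 (rshift m b).
pose o b (z : 'rV[R]_(m + r)) : R := ((omega (S b) \o cinv phi) \o lsubmx) z.
have sb b : smooth_at (omega (S b) \o cinv phi) (cmap phi (vproj w)).
  by apply: smooth_atM_chart => //; apply: smooth_fun_at; exact: oP.1.
have so b : smooth_at (o b) (coords w).
  apply: (@smooth_at_comp _ _ _ (omega (S b) \o cinv phi) (@lsubmx R 1 m r)).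
    by rewrite /coords row_mxKl.
  move=> j; apply: (@smooth_at_eq _ _ (fun z => z 0 (lshift r j))).
    by near=> z; rewrite mxE.
  by move=> l; exact: Ck_at_coord.
have dq b v : is_derive (coords w) v (q b) (v 0 (rshift m b)) by exact: derive_coord.
have d_o b : derivable (o b) (coords w) (delta_mx 0 k) by exact: smooth_at_derivable.
rewrite (@near_eq_derive _ _ _ _ (\sum_b (q b * o b))); last first.
  have n1 := near_cinv_coords wa (near_tdom ws).
  have n2 := near_cinv_coords wa (nbhs_interior wS).
  apply: filterS2 n1 n2 => z zs zS.
  rewrite /= (@hat_frame _ _ _ _ _ _ oP s S) //; last first.
  - by rewrite /local_param tpoint_proj.
  - by rewrite /local_param tpoint_proj.
  rewrite fct_sumE; apply: eq_bigr => b _.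
  by rewrite /local_param tpoint_proj // tpointK // mxE.
have dqo b : 'D_(delta_mx 0 k) (q b * o b) (coords w) =
    tcoord s w 0 b *
      'D_(lsubmx (delta_mx 0 k)) (omega (S b) \o cinv phi) (cmap phi (vproj w))
    + omega (S b) (vproj w) * (delta_mx 0 k : 'rV[R]_(m + r)) 0 (rshift m b).
  have [dqb qbE] := dq b (delta_mx 0 k).
  rewrite deriveM // qbE (_ : o b = (omega (S b) \o cinv phi) \o lsubmx) //.
  by rewrite derive_lsubmx /q /coords /= row_mxKl row_mxEr cmapK.
rewrite derive_sum => [|b]; last first.
  by have [dqb _] := dq b (delta_mx 0 k); apply: derivableM => //; exact: d_o.
under eq_bigr do rewrite dqo.
case: splitP => [j kj|a ka].
  have -> : k = lshift r j by exact: val_inj.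
  apply: eq_bigr => b _; rewrite lsubmx_delta_l mxE eq_rlshift andbF.
  by rewrite mulr0 addr0.
have -> : k = rshift m a by exact: val_inj.
rewrite (bigD1 a) //= big1 ?addr0 => [|b ba].
  by rewrite lsubmx_delta_r derive0 mulr0 add0r mxE !eqxx mulr1.
by rewrite lsubmx_delta_r derive0 mulr0 add0r mxE eqxx /= eq_rshift (negbTE ba) mulr0.
Unshelve. all: by end_near. Qed.

Lemma local_lift_hat w omega : adapted (vproj w) -> one_form omega ->
  local_lift w (hat omega) = hat (lie_derivative A g g' u omega) w.
Proof.
move=> wa oP; have [wd ws wS _] := wa.
have lP := lie_derivative_one_form A g_morphism g_inverse u_section oP.
rewrite /local_lift asboolT; last exact: hat_smooth.
under eq_bigr do rewrite derive_hat //.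
rewrite big_split_ord /= (hat_frame lP ws S_smooth wS).
under eq_bigr do rewrite (unsplitK (inl _)) /lift_coef row_mxEl mxE mulr_sumr.
under [X in _ + X]eq_bigr do
  rewrite (unsplitK (inr _)) /lift_coef row_mxEr mxE mulNr mulr_suml -sumrN.
rewrite exchange_big [X in _ + X]exchange_big /= -big_split; apply: eq_bigr => b _ /=.
rewrite /lie_derivative -/(X _ _) -/(L _).
have sL : smooth_section (L (S b)) by exact: lie_section_smooth.
rewrite (one_form_frame oP ws S_smooth wS sL) base_field_chart //; last exact: oP.1.
rewrite mulrBr !mulr_sumr -sumrN; congr (_ + _); apply: eq_bigr => j _; ring.
Qed.

Lemma local_lift_smooth w f : adapted (vproj w) -> smooth_fun f ->
  smooth_atM (fun w' => local_lift w' f) w.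
Proof.
move=> [wd ws _ _] sf.
have sv := @smooth_at_vproj _ _ _ _ _ w.
have sc k : smooth_atM (fun w' => coords w' 0 k) w.
  apply: smooth_atM_row_mx => [j|a]; last exact: smooth_at_tcoord.
  apply: (@smooth_at_MMR _ _ _ _ _ (vproj (b := E)) (fun x => cmap phi x 0 j)) => //.
  exact: smooth_at_cmap.
have sl k : smooth_atM (fun w' => lift_coef w' 0 k) w.
  apply: smooth_atM_row_mx => [j|a].
    apply: (@smooth_atM_eq _ _ _ (X (Fx j) \o vproj (b := E))).
      by near=> w'; rewrite mxE.
    apply: smooth_at_MMR => //; apply: smooth_fun_at.
    exact: base_field_smooth.
  apply: (@smooth_atM_eq _ _ _ (fun w' => (-1) *
      \sum_b tcoord s w' 0 b * tcoord s (L (S b) (vproj w')) 0 a)).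
    by near=> w'; rewrite mxE mulN1r.
  apply: smooth_atM_mul; first exact: smooth_atM_cst.
  apply: smooth_atM_sum => b; apply: smooth_atM_mul; first exact: smooth_at_tcoord.
  apply: (@smooth_at_MMR _ _ _ _ _ (vproj (b := E))
    (fun x => tcoord s (L (S b) x) 0 a)) => //.
  by apply: section_smooth => //; exact: lie_section_smooth.
rewrite /local_lift asboolT //; apply: smooth_atM_sum => k; apply: smooth_atM_mul => //.
apply: (@smooth_at_MRR _ _ _ _ coords
  (fun y => 'D_(delta_mx 0 k) (f \o local_param s phi) y)) => //.
apply: smooth_at_partial; apply: smooth_at_RMR; first exact: smooth_at_local_param.
exact: smooth_fun_at.
Unshelve. all: by end_near. Qed.

Lemma local_lift_is_lift w : adapted (vproj w) -> is_lift w (local_lift w).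
Proof.
move=> wa; split; [exact: local_lift_tangent| |by move=> omega; exact: local_lift_hat].
have su := push_section g_morphism u_section.
apply/funext => k; rewrite /tangent_map; case: asboolP => sk; last first.
  by rewrite ((anchor_vf A su).1 _).2.
rewrite -[k \o _]/((k \o h) \o vproj (b := E)) local_lift_base //; last first.
  by apply: smooth_fun_comp => //; exact: (@dfun_smooth _ _ _ _ _ h).
rewrite /base_field; congr (anchor _ _ _ _); apply/funext => q /=.
by rewrite dinvK.
Qed.

End LocalCoordinates.

Lemma local_lift_exists w0 : exists D : E -> (E -> R) -> R,
  (\forall w \near w0, is_lift w (D w)) /\
  forall f, smooth_fun f -> smooth_atM (fun w => D w f) w0.
Proof.
have [phi aphi wd] := atlas_cover (vproj w0); have [s ws] := vtriv E (vproj w0).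
have [S [sS SE]] := local_frame ws.
have [Fx [sF FE]] := chart_extend aphi wd.
have na : \forall x \near vproj w0, adapted phi s S Fx x.
  have nF := nbhs_interior FE.
  have nd : \forall x \near vproj w0, cdom phi x /\ tdom s x.
    by apply: filterI; [exact: near_cdom|exact: near_tdom].
  by apply: filterS3 nd (nbhs_interior SE) nF => x [xd xs] xS xF; split.
exists (local_lift phi s S Fx); split.
  by apply: filterS (near_vproj na) => w wa; exact: local_lift_is_lift.
by move=> f sf; apply: local_lift_smooth => //; exact: nbhs_singleton na.
Qed.

End CompleteLift.

Theorem theorem11 (R : realType) (m p r : nat) (M N : manifold R m)
    (h : diffeomorphism M N) (eta : diffeomorphism N M)
    (F : vectorBundle N p) (A : genLieAlgebroid h eta F)
    (E : vectorBundle M r)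
    (g : E -> F) (g_morphism : bundle_morphism h g)
    (g' : F -> E) (g_inverse : local_inverse h g g')
    (u : M -> E) (u_section : smooth_section u) :
  exists! uc : E -> (E -> R) -> R,
    [/\ vector_field uc,
        forall w : E, tangent_map (h \o vproj (b := E)) (uc w)
                      = anchor A (push h g u) (h (vproj w)) &
        forall omega : (M -> E) -> M -> R, one_form omega ->
          (fun w => uc w (hat omega)) = hat (lie_derivative A g g' u omega)].
Proof.
have loc := local_lift_exists A g_morphism g_inverse u_section.
have pt w : exists D, is_lift A g g' u w D.
  by have [D [/nbhs_singleton lD _]] := loc w; exists (D w).
have [uc ucP] := choice pt.
exists uc; split; first split.
- split=> [w|f sf]; first by have [] := ucP w.
  apply/smooth_funP => w0; have [D [lD sD]] := loc w0.
  apply: smooth_atM_eq (sD f sf); apply: filterS lD => w lw.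
  by rewrite (is_lift_unique lw (ucP w)).
- by move=> w; have [] := ucP w.
- by move=> omega oP; apply/funext => w; have [_ _ ->] := ucP w.
- move=> uc' [[tu _] bu hu]; apply/funext => w.
  apply: (is_lift_unique (ucP w)); split=> // omega oP.
  by rewrite -(hu omega oP).
Qed.
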